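(* For $\epsilon>0$ consider the LQG problem with $n=2$, $m=p=1$ and $$A=\tfrac32\begin{bmatrix}-1&0\\ 0&-1-\epsilon\end{bmatrix},\quad B=\begin{bmatrix}1\\ 1+\epsilon\end{bmatrix},\quad C=\begin{bmatrix}1&1\end{bmatrix},\quad Q=\begin{bmatrix}4&1\\ 1&4\end{bmatrix},\quad W=\begin{bmatrix}4&1+\epsilon\\ 1+\epsilon&4(1+\epsilon)^2\end{bmatrix},\quad V=R=1,$$ and the globally optimal controller $$\mathsf K^*=\begin{bmatrix}0&-1&-1\\ 1&-\frac72&-2\\ 1+\epsilon&-2(1+\epsilon)&-\frac72(1+\epsilon)\end{bmatrix}$$ (which is controllable and observable). Let $$\Delta_0=\begin{bmatrix}0&0&0\\ 0&-1/2&1/2\\ 0&1/2&-1/2\end{bmatrix},\qquad \Delta_1=\begin{bmatrix}0&-1/2&-1/2\\ 1/2&0&0\\ 1/2&0&0\end{bmatrix}.$$ Then, as $\epsilon\to0$, $$\operatorname{Hess}_{\mathsf K^*}(\Delta_0,\Delta_0)=\left.\frac{d^2J(\mathsf K^*+t\Delta_0)}{dt^2}\right|_{t=0}=\frac{3}{7000}\epsilon^4+o(\epsilon^4),$$ $$\operatorname{Hess}_{\mathsf K^*}(\Delta_1,\Delta_1)=\left.\frac{d^2J(\mathsf K^*+t\Delta_1)}{dt^2}\right|_{t=0}=\frac{680}{343}+o(1),$$ and $$\left\|\operatorname{Proj}_{\mathcal{TO}_{\mathsf K^*}}[\Delta_0]\right\|_F=O(\epsilon).$$ Consequently, as $\epsilon\to0$,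 $$\min_{\Delta\perp\mathcal{TO}_{\mathsf K^*}}\frac{\operatorname{Hess}_{\mathsf K^*}(\Delta,\Delta)}{\|\Delta\|_F^2}\le\frac{\operatorname{Hess}_{\mathsf K^*}(\Delta_0,\Delta_0)}{\|\Delta_0\|_F^2-\|\operatorname{Proj}_{\mathcal{TO}_{\mathsf K^*}}[\Delta_0]\|_F^2}=\frac{3}{7000}\epsilon^4+o(\epsilon^4),$$ $$\max_{\Delta\perp\mathcal{TO}_{\mathsf K^*}}\frac{\operatorname{Hess}_{\mathsf K^*}(\Delta,\Delta)}{\|\Delta\|_F^2}\ge\frac{\operatorname{Hess}_{\mathsf K^*}(\Delta_1,\Delta_1)}{\|\Delta_1\|_F^2}=\frac{680}{343}+o(1),$$ and the reciprocal condition number of $\operatorname{Hess}_{\mathsf K^*}$ restricted to $\mathcal{TO}_{\mathsf K^*}^\perp$ can be upper bounded by $$\operatorname{rcond}_{\mathsf K^*}\le\frac{147}{680000}\epsilon^4+o(\epsilon^4)\approx2.16\times10^{-4}\cdot\epsilon^4+o(\epsilon^4).$$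
   Context: General LQG setting. For a plant $(A,B,C)$ with $A\in\mathbb{R}^{n\times n}$, $B\in\mathbb{R}^{n\times m}$, $C\in\mathbb{R}^{p\times n}$ and weights $W,Q\succeq0$, $V,R\succ0$, let $\mathcal{V}_n$ be the linear space of matrices $\mathsf K=\begin{bmatrix}0_{m\times p}&C_{\mathsf K}\\ B_{\mathsf K}&A_{\mathsf K}\end{bmatrix}\in\mathbb{R}^{(m+n)\times(p+n)}$ with $A_{\mathsf K}\in\mathbb{R}^{n\times n}$, $B_{\mathsf K}\in\mathbb{R}^{n\times p}$, $C_{\mathsf K}\in\mathbb{R}^{m\times n}$, with inner product $\operatorname{tr}(U^{\mathsf T}\Delta)$ and Frobenius norm $\|\cdot\|_F$. A real square matrix is stable if all its eigenvalues have negative real part. $\mathcal{C}_n\subseteq\mathcal{V}_n$ is the (open) subset of those $\mathsf K$ for which $A_{\mathrm{cl},\mathsf K}=\begin{bmatrix}A&BC_{\mathsf K}\\ B_{\mathsf K}C&A_{\mathsf K}\end{bmatrix}$ is stable. The LQG cost $J=J_n:\mathcal{C}_n\to\mathbb{R}$ is $$J(\mathsf K)=\operatorname{tr}\left(\begin{bmatrix}Q&0\\ 0&C_{\mathsf K}^{\mathsf T}RC_{\mathsf K}\end{bmatrix}X_{\mathsf K}\right),\qquad A_{\mathrm{cl},\mathsf K}X_{\mathsf K}+X_{\mathsf K}A_{\mathrm{cl},\mathsf K}^{\mathsf T}+\begin{bmatrix}W&0\\ 0&B_{\mathsf K}VB_{\mathsf K}^{\mathsf T}\end{bmatrix}=0,$$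 where $X_{\mathsf K}$ is the unique solution; it is real analytic. $\operatorname{Hess}_{\mathsf K}:\mathcal{V}_n\times\mathcal{V}_n\to\mathbb{R}$ is the symmetric bilinear form of second derivatives of $J$ at $\mathsf K$. For controllable and observable $\mathsf K\in\mathcal{C}_n$ (meaning $(A_{\mathsf K},B_{\mathsf K})$ controllable and $(C_{\mathsf K},A_{\mathsf K})$ observable), the orbit $$\mathcal{O}_{\mathsf K}=\left\{\begin{bmatrix}0&C_{\mathsf K}T^{-1}\\ TB_{\mathsf K}&TA_{\mathsf K}T^{-1}\end{bmatrix}\ \middle|\ T\in\mathbb{R}^{n\times n}\text{ invertible}\right\}$$ is an embedded submanifold of dimension $n^2$; $\mathcal{TO}_{\mathsf K}\subseteq\mathcal{V}_n$ is its tangent space at $\mathsf K$, $\mathcal{TO}_{\mathsf K}^\perp$ its orthogonal complement in $\mathcal{V}_n$, and $\operatorname{Proj}_{\mathcal{TO}_{\mathsf K}}$ the orthogonal projection of $\mathcal{V}_n$ onto it. The minima and maxima over $\Delta\perp\mathcal{TO}_{\mathsf K^*}$ are over nonzero $\Delta\in\mathcal{TO}_{\mathsf K^*}^\perp$, and $$\operatorname{rcond}_{\mathsf K^*}=\frac{\min_{\Delta\perp\mathcal{TO}_{\mathsf K^*}}\operatorname{Hess}_{\mathsf K^*}(\Delta,\Delta)/\|\Delta\|_F^2}{\max_{\Delta\perp\mathcal{TO}_{\mathsf K^*}}\operatorname{Hess}_{\mathsf K^*}(\Delta,\Delta)/\|\Delta\|_F^2}.$$ The matrices $A,B,Q,W,\mathsf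 K^*$ (hence $J$, $\operatorname{Hess}_{\mathsf K^*}$, $\mathcal{TO}_{\mathsf K^*}$) depend on $\epsilon$. *)

(* Defs.v *)
From HB Require Import structures.
From mathcomp Require Import all_boot all_order all_algebra.
From mathcomp Require Import complex ring lra.
From mathcomp Require Import all_classical all_reals all_analysis.
Set Implicit Arguments.
Unset Strict Implicit.
Unset Printing Implicit Defensive.
Import Order.TTheory GRing.Theory Num.Theory.
Import numFieldNormedType.Exports.
Local Open Scope classical_set_scope.
Local Open Scope ring_scope.

Section LinearSystems.
Variable R : realType.

Definition stable n (M : 'M[R]_n) : Prop :=
  forall z : R[i], eigenvalue (map_mx (real_complex R) M) z -> complex.Re z < 0.

Definition psd n (M : 'M[R]_n) : Prop :=
  M^T = M /\ forall x : 'cV[R]_n, 0 <= (x^T *m M *m x) 0 0.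

Definition posdef n (M : 'M[R]_n) : Prop :=
  M^T = M /\ forall x : 'cV[R]_n, x != 0 -> 0 < (x^T *m M *m x) 0 0.

Definition controllable n m (A : 'M[R]_n) (B : 'M[R]_(n, m)) : Prop :=
  \rank (\mxrow_(i < n) (A ^+ i *m B)) = n.

Definition observable n p (C : 'M[R]_(p, n)) (A : 'M[R]_n) : Prop :=
  \rank (\mxcol_(i < n) (C *m A ^+ i)) = n.

Definition lyapunov_sol n (A N X : 'M[R]_n) : Prop :=
  A *m X + X *m A^T + N = 0.

Definition finner m n (U D : 'M[R]_(m, n)) : R := \tr (U^T *m D).
Definition fnorm m n (D : 'M[R]_(m, n)) : R := Num.sqrt (finner D D).

End LinearSystems.

Record lqg (R : realType) (n m p : nat) := LQG {
  plantA : 'M[R]_n;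
  plantB : 'M[R]_(n, m);
  plantC : 'M[R]_(p, n);
  costQ : 'M[R]_n;
  costR : 'M[R]_m;
  noiseW : 'M[R]_n;
  noiseV : 'M[R]_p;
  _ : psd costQ;
  _ : posdef costR;
  _ : psd noiseW;
  _ : posdef noiseV }.

Section LQGCost.
Variables (R : realType) (n m p : nat) (P : lqg R n m p).

(* A controller is a matrix [[0, C_K]; [B_K, A_K]] of the space V_n, i.e. an
   element of [in_Vn]. The functions below are total on the ambient matrix space
   and ignore its upper left block, so that derivatives along directions of V_n
   only involve their values on V_n. *)
Local Notation ctrl := 'M[R]_(m + n, p + n).

Definition in_Vn : set ctrl := [set K | ulsubmx K = 0].

Definition CK (K : ctrl) : 'M[R]_(m, n) := ursubmx K.
Definition BK (K : ctrl) : 'M[R]_(n, p) := dlsubmx K.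
Definition AK (K : ctrl) : 'M[R]_n := drsubmx K.

Definition Acl (K : ctrl) : 'M[R]_(n + n) :=
  block_mx (plantA P) (plantB P *m CK K) (BK K *m plantC P) (AK K).

Definition Cn : set ctrl := [set K | in_Vn K /\ stable (Acl K)].

Definition noise_mx (K : ctrl) : 'M[R]_(n + n) :=
  block_mx (noiseW P) 0 0 (BK K *m noiseV P *m (BK K)^T).

Definition cost_mx (K : ctrl) : 'M[R]_(n + n) :=
  block_mx (costQ P) 0 0 ((CK K)^T *m costR P *m CK K).

(* On [Cn] the Lyapunov equation has exactly one solution; [xget] selects it. *)
Definition XK (K : ctrl) : 'M[R]_(n + n) :=
  xget 0 [set X | lyapunov_sol (Acl K) (noise_mx K) X].

Definition J (K : ctrl) : R := \tr (cost_mx K *m XK K).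

Definition globally_optimal (K : ctrl) : Prop :=
  Cn K /\ forall L, Cn L -> J K <= J L.

Definition Hess (K U D : ctrl) : R := 'D_U (fun L => 'D_D J L) K.

End LQGCost.

Section Orbit.
Variables (R : realType) (n m p : nat).
Local Notation ctrl := 'M[R]_(m + n, p + n).

Definition controllable_observable (K : ctrl) : Prop :=
  controllable (AK K) (BK K) /\ observable (CK K) (AK K).

Definition orbit (K : ctrl) : set ctrl :=
  [set L | exists2 T : 'M[R]_n, T \in unitmx &
     L = block_mx 0 (CK K *m invmx T) (T *m BK K) (T *m AK K *m invmx T)].

(* Velocities at time 0 of the smooth curves through K drawn on the orbit. *)
Definition TO (K : ctrl) : set ctrl :=
  [set D | exists c : R -> ctrl,
     [/\ c 0 = K,
         \forall t \near (0 : R), orbit K (c t) /\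
           forall (k : nat) i j, derivable (derive1n k (fun s => c s i j)) t 1 &
         forall i j, derive1 (fun s => c s i j) 0 = D i j]].

Definition TOperp (K : ctrl) : set ctrl :=
  [set D | in_Vn D /\ forall U, TO K U -> finner U D = 0].

Definition ProjTO (K D : ctrl) : ctrl :=
  xget 0 [set U | TO K U /\ TOperp K (D - U)].

Variable P : lqg R n m p.

Definition rayleigh (K : ctrl) : set R :=
  [set Hess P K D D / fnorm D ^+ 2 | D in [set D | TOperp K D /\ D != 0]].

Definition minimum (S : set R) : set R := S `&` lbound S.
Definition maximum (S : set R) : set R := S `&` ubound S.

Definition minRayleigh (K : ctrl) : R := xget 0 (minimum (rayleigh K)).
Definition maxRayleigh (K : ctrl) : R := xget 0 (maximum (rayleigh K)).

Definition rcond (K : ctrl) : R := minRayleigh K / maxRayleigh K.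

End Orbit.

Section Example.
Variable R : realType.

Definition mx_of_rows m n (s : seq (seq R)) : 'M[R]_(m, n) :=
  \matrix_(i, j) nth 0 (nth [::] s i) j.

Definition exA (e : R) : 'M[R]_2 :=
  (3 / 2) *: mx_of_rows 2 2 [:: [:: -1; 0]; [:: 0; -1 - e]].
Definition exB (e : R) : 'M[R]_(2, 1) := mx_of_rows 2 1 [:: [:: 1]; [:: 1 + e]].
Definition exC : 'M[R]_(1, 2) := mx_of_rows 1 2 [:: [:: 1; 1]].
Definition exQ : 'M[R]_2 := mx_of_rows 2 2 [:: [:: 4; 1]; [:: 1; 4]].
Definition exW (e : R) : 'M[R]_2 :=
  mx_of_rows 2 2 [:: [:: 4; 1 + e]; [:: 1 + e; 4 * (1 + e) ^+ 2]].

Lemma psd22 (a b c : R) : 0 <= a -> 0 <= c -> b ^+ 2 <= a * c ->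
  psd (mx_of_rows 2 2 [:: [:: a; b]; [:: b; c]]).
Proof.
move=> a0 c0 bac; split.
  by apply/matrixP => i j; rewrite !mxE; move: i j; do 2![case; case=> [|[|//]] ?].
move=> x; rewrite !mxE !big_ord_recl big_ord0 !mxE !big_ord_recl !big_ord0 !mxE /=.
move: (x ord0 0) (x (lift ord0 ord0) 0) => u v.
rewrite [leRHS](_ : _ = a * u ^+ 2 + 2 * b * u * v + c * v ^+ 2); last by ring.
have [a_eq0|a_neq0] := eqVneq a 0.
  have b_eq0 : b = 0.
    by apply/eqP; rewrite -sqrf_eq0 eq_le sqr_ge0 andbT (le_trans bac)// a_eq0 mul0r.
  by rewrite a_eq0 b_eq0 mulr0 !mul0r !add0r mulr_ge0 ?sqr_ge0.
have a_gt0 : 0 < a by rewrite lt_def a_neq0.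
rewrite -(pmulr_rge0 _ a_gt0).
have -> : a * (a * u ^+ 2 + 2 * b * u * v + c * v ^+ 2)
  = (a * u + b * v) ^+ 2 + (a * c - b ^+ 2) * v ^+ 2 by ring.
by rewrite addr_ge0 ?sqr_ge0// mulr_ge0 ?sqr_ge0// subr_ge0.
Qed.

Lemma exQ_psd : psd exQ.
Proof. by apply: psd22; rewrite ?ler0n// expr1n -natrM ler1n. Qed.

Lemma exW_psd e : psd (exW e).
Proof.
have e2 := sqr_ge0 (1 + e).
by apply: psd22; [lra|lra|rewrite mulrCA; lra].
Qed.

Lemma one_posdef : posdef (1%:M : 'M[R]_1).
Proof.
split=> [|x x0]; first by rewrite trmx1.
rewrite mulmx1 !mxE big_ord1 !mxE -expr2 lt_def sqr_ge0 andbT sqrf_eq0.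
apply: contraNneq x0 => x00; apply/eqP/matrixP => i j.
by rewrite !ord1 x00 mxE.
Qed.

Definition ex_lqg (e : R) : lqg R 2 1 1 :=
  LQG (exA e) (exB e) exC exQ_psd one_posdef (exW_psd e) one_posdef.

Definition Kstar (e : R) : 'M[R]_(1 + 2, 1 + 2) :=
  mx_of_rows _ _
    [:: [:: 0; -1; -1];
        [:: 1; - (7 / 2); -2];
        [:: 1 + e; -2 * (1 + e); - (7 / 2) * (1 + e)]].

Definition Delta0 : 'M[R]_(1 + 2, 1 + 2) :=
  mx_of_rows _ _
    [:: [:: 0; 0; 0];
        [:: 0; - (1 / 2); 1 / 2];
        [:: 0; 1 / 2; - (1 / 2)]].

Definition Delta1 : 'M[R]_(1 + 2, 1 + 2) :=
  mx_of_rows _ _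
    [:: [:: 0; - (1 / 2); - (1 / 2)];
        [:: 1 / 2; 0; 0];
        [:: 1 / 2; 0; 0]].

Definition HessK (e : R) (D : 'M[R]_(1 + 2, 1 + 2)) : R :=
  Hess (ex_lqg e) (Kstar e) D D.
Definition minR (e : R) : R := minRayleigh (ex_lqg e) (Kstar e).
Definition maxR (e : R) : R := maxRayleigh (ex_lqg e) (Kstar e).
Definition rcondK (e : R) : R := rcond (ex_lqg e) (Kstar e).

End Example.

(* Main.v *)
Require Import Defs.
From HB Require Import structures.
From mathcomp Require Import all_boot all_order all_algebra.
From mathcomp Require Import complex ring lra.
From mathcomp Require Import all_classical all_reals all_analysis.
Set Implicit Arguments.
Unset Strict Implicit.
Unset Printing Implicit Defensive.
Import Order.TTheory GRing.Theory Num.Theory.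
Import numFieldNormedType.Exports.
Local Open Scope classical_set_scope.
Local Open Scope ring_scope.

(**
Let F, G be the optimal state feedback and observer gains of the two Riccati
equations. Completing the squares shows that the cost of every stabilizing
controller exceeds the constant J* by |H|^2, the squared H2 norm of the system with
state matrix A_cl, input [G; B_K] and output [F, C_K]; this is nonnegative, since
the solution of a Lyapunov equation with stable matrix and positive semidefinite
right-hand side is positive semidefinite, and it vanishes at K*.

Along a line K* + tD the system H is t times a system depending polynomially on t.
Hence J(K* + tD) = J* + t^2 r(t) with r rational and regular at 0, and
Hess(D, D) = 2 r(0) is twice the squared H2 norm of the linearized system
[N, alpha; 0, N], [beta; G], [F, gamma] with alpha = B c - b C - a, beta = -b,
gamma = c for D = [0, c; b, a]. Velocities [0, -C_K S; S B_K, S A_K - A_K S] along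
the orbit only change this system by a similarity, so Hess(D + U, D + U) =
Hess(D, D) for U tangent to the orbit: the Rayleigh quotient of any D can be compared
with that of its component orthogonal to the orbit.

For the example A - B F = A - G C, so all the Lyapunov equations are 2x2 and the
Hessian is an explicit rational function of e.
*)

(** * Lyapunov equations *)

Lemma mx_addE (V : nmodType) m n (A B : 'M[V]_(m, n)) i j :
  (A + B) i j = A i j + B i j.
Proof. by rewrite mxE. Qed.

Lemma mx_oppE (V : zmodType) m n (A : 'M[V]_(m, n)) i j : (- A) i j = - A i j.
Proof. by rewrite mxE. Qed.

Lemma mx_zeroE (V : nmodType) m n i j : (0 : 'M[V]_(m, n)) i j = 0.
Proof. by rewrite mxE. Qed.

Lemma mx_scaleE (R : pzSemiRingType) m n (a : R) (A : 'M[R]_(m, n)) i j :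
  (a *: A) i j = a * A i j.
Proof. by rewrite mxE. Qed.

Definition mx_linE := (mx_addE, mx_oppE, mx_zeroE, mx_scaleE).

(* Identities between sums of matrix products: distribute, then let [ring]
   treat each entry of each product as an atom. *)
Ltac mxring := apply/matrixP => ? ?; rewrite ?mx_linE; ring.

Lemma eigenvalue_similar (F : fieldType) n (A T : 'M[F]_n) z : T \in unitmx ->
  eigenvalue (T *m A *m invmx T) z = eigenvalue A z.
Proof.
move=> Tu; apply/eigenvalueP/eigenvalueP => -[v ev vn0].
  exists (v *m T).
    by rewrite scalemxAl -ev !mulmxA mulmxKV.
  by apply: contraNneq vn0 => vT0; rewrite -(mulmxK Tu v) vT0 mul0mx.
exists (v *m invmx T).
  by rewrite !mulmxA mulmxKV // ev scalemxAl.
by apply: contraNneq vn0 => vT0; rewrite -(mulmxKV Tu v) vT0 mul0mx.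
Qed.

(** * Positivity of Lyapunov solutions over a closed field *)

Section PsdLyapunov.
Variable C : numClosedFieldType.
Local Open Scope sesquilinear_scope.
Local Notation "M ^t*" := ((M ^T) ^ (@Num.conj C)) (at level 30).

Definition hpsd n (M : 'M[C]_n) :=
  forall x : 'cV[C]_n, 0 <= (x^t* *m M *m x) 0 0.

Lemma hconjM m n p (A : 'M[C]_(m, n)) (B : 'M[C]_(n, p)) :
  (A *m B)^t* = B^t* *m A^t*.
Proof. by rewrite trmx_mul map_mxM. Qed.

Lemma hconjD m n (A B : 'M[C]_(m, n)) : (A + B)^t* = A^t* + B^t*.
Proof. by apply/matrixP => i j; rewrite !mxE rmorphD. Qed.

Lemma hconjZ m n c (A : 'M[C]_(m, n)) : (c *: A)^t* = c^* *: A^t*.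
Proof. by apply/matrixP => i j; rewrite !mxE rmorphM. Qed.

Lemma hconjK m n (A : 'M[C]_(m, n)) : A^t*^t* = A.
Proof. exact: trmxCK. Qed.

Lemma hpsd_congr n (X T : 'M[C]_n) : T \in unitmx -> hpsd (T *m X *m T^t*) -> hpsd X.
Proof.
move=> Tu TX x; have := TX ((invmx T)^t* *m x).
rewrite hconjM hconjK !mulmxA mulmxKV // -[_ *m T^t* *m _]mulmxA -hconjM.
by rewrite mulVmx // trmx1 map_mx1 mulmx1.
Qed.

Lemma dotH_ge0 n (x : 'rV[C]_n) : 0 <= (x *m x^t*) 0 0.
Proof.
rewrite !mxE; apply: sumr_ge0 => i _; rewrite !mxE; exact: mul_conjC_ge0.
Qed.

Lemma dotH_eq0 n (x : 'rV[C]_n) : (x *m x^t*) 0 0 = 0 -> x = 0.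
Proof.
rewrite !mxE => /eqP; rewrite psumr_eq0 => [/allP /= h|i _]; last first.
  by rewrite !mxE mul_conjC_ge0.
apply/rowP => i; have := h i (mem_index_enum i); rewrite !mxE mul_conjC_eq0.
by move/eqP.
Qed.

Lemma lyap_congr n k (A X T : 'M[C]_n) (G : 'M[C]_(n, k)) : T \in unitmx ->
  A *m X + X *m A^t* + G *m G^t* = 0 ->
  (T *m A *m invmx T) *m (T *m X *m T^t*)
  + (T *m X *m T^t*) *m (T *m A *m invmx T)^t* + (T *m G) *m (T *m G)^t* = 0.
Proof.
move=> Tu /(congr1 (fun M => T *m M *m T^t*)); rewrite mulmx0 mul0mx => <-.
rewrite !hconjM !mulmxDr !mulmxDl !mulmxA mulmxKV //; congr (_ + _ + _).
rewrite -[_ *m T^t* *m _]mulmxA -hconjM mulVmx // trmx1 map_mx1 mulmx1.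
by [].
Qed.

(** Induction on the size by Schur complements. The corner entry [x] satisfies
    [2 Re(a) x = - |g|^2], so it is nonnegative. The column [y] below it is a multiple of [x], and
    clearing it by a congruence leaves a Schur complement that solves a Lyapunov equation for the
    trailing block [A]. *)
Lemma lyap_psd_trig n k (A X : 'M[C]_n) (G : 'M[C]_(n, k)) : is_trig_mx A ->
  (forall i, A i i + (A i i)^* < 0) -> X^t* = X ->
  A *m X + X *m A^t* + G *m G^t* = 0 -> hpsd X.
Proof.
pose P m (M : 'M[C]_m) := forall (X : 'M[C]_m) (G : 'M[C]_(m, k)),
  (forall i, M i i + (M i i)^* < 0) -> X^t* = X ->
  M *m X + X *m M^t* + G *m G^t* = 0 -> hpsd X.
move=> tA; move: X G; apply: (@trigsqmx_ind _ P) tA => {n A} [X G _ _ _ x|].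
  by rewrite [x]flatmx0 mulmx0 mxE.
move=> n0 a b A tA IH X G stA hX eqn.
have sta : a 0 0 + (a 0 0)^* < 0 by have := stA (lshift _ 0); rewrite block_mxEul.
have stA' i : A i i + (A i i)^* < 0 by have := stA (rshift _ i); rewrite block_mxEdr.
move: hX eqn; rewrite -(submxK X) -(vsubmxK G).
move: (ulsubmx X) (ursubmx X) (dlsubmx X) (drsubmx X) (usubmx G) (dsubmx G).
move=> {X G} x y' y X g G; rewrite tr_block_mx map_block_mx.
case/eq_block_mx => hx hy _ hX; rewrite -{}hy.
have xC : (x 0 0)^* = x 0 0 by rewrite -[in RHS]hx !mxE.
move=> /[dup] eqn.
rewrite tr_block_mx map_block_mx tr_col_mx map_row_mx !mulmx_block mul_col_row.
rewrite !add_block_mx trmx0 map_mx0 !(mulmx0, mul0mx, addr0, add0r).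
rewrite -block_mx0 => /eq_block_mx [e11 _ e21 e22].
have e11' : (a 0 0 + (a 0 0)^*) * x 0 0 + (g *m g^t*) 0 0 = 0.
  move: e11 => /matrixP /(_ 0 0); rewrite !mx_linE => <-.
  congr (_ + _); rewrite ![in RHS]mxE !big_ord1 !mxE; ring.
have x_ge0 : 0 <= x 0 0.
  have : (a 0 0 + (a 0 0)^*) * x 0 0 <= 0.
    by rewrite -(lerD2r ((g *m g^t*) 0 0)) e11' add0r dotH_ge0.
  by rewrite nmulr_rle0.
have [k0 ek] : exists k0 : 'cV[C]_n0, y = x 0 0 *: k0.
  have [x0|xn0] := eqVneq (x 0 0) 0; last first.
    by exists ((x 0 0)^-1 *: y); rewrite scalerA mulfV // scale1r.
  (* If [x = 0] then [g = 0], and the off-diagonal equation becomes homogeneous in [y], with matrix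
     [A + conj(a)]. *)
  exists 0; rewrite scaler0.
  have g0 : g = 0 by apply: dotH_eq0; move: e11'; rewrite x0 mulr0 add0r.
  have x00 : x = 0 by apply/matrixP => i j; rewrite !ord1 x0 mxE.
  move: e21; rewrite x00 g0 trmx0 map_mx0 !mulmx0 add0r addr0 => e21.
  have ea : a^t* = ((a 0 0)^*)%:M.
    by apply/matrixP => i j; rewrite !ord1 !mxE eqxx mulr1n.
  have : (A + ((a 0 0)^*)%:M) *m y = 0 by rewrite mulmxDl -e21 ea mul_mx_scalar mul_scalar_mx.
  suff Au : A + ((a 0 0)^*)%:M \in unitmx.
    by move/(congr1 (mulmx (invmx (A + ((a 0 0)^*)%:M)))); rewrite mulKmx // mulmx0.
  rewrite unitmxE unitfE det_trig; last first.
    apply/is_trig_mxP => i j ij; rewrite !mxE (is_trig_mxP _ _) //.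
    by rewrite -val_eqE ltn_eqF //= mulr0n addr0.
  (* A vanishing diagonal entry would give [A i i = - conj(a)], whose real part is positive because
     that of [a] is negative. *)
  apply/prodf_neq0 => i _; rewrite !mxE eqxx mulr1n.
  apply/eqP => /eqP; rewrite addr_eq0 => /eqP h.
  have := stA' i; rewrite h rmorphN /= conjCK -opprD oppr_lt0 => h2.
  by have := lt_trans sta h2; rewrite addrC ltxx.
(* [T] eliminates [y]. As it is unipotent lower triangular, conjugation by it keeps [A] as the
   trailing block. *)
pose T : 'M[C]_(1 + n0) := block_mx 1%:M 0 (- k0) 1%:M.
pose Ti : 'M[C]_(1 + n0) := block_mx 1%:M 0 k0 1%:M.
have TTi : T *m Ti = 1%:M.
  rewrite mulmx_block !(mulmx0, mul0mx, mulmx1, mul1mx, addr0, add0r).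
  by rewrite addNr -scalar_mx_block.
have Tu : T \in unitmx by case/mulmx1_unit: TTi.
have iT : invmx T = Ti by rewrite -[LHS]mulmx1 -TTi mulKmx.
have xE : x = (x 0 0)%:M by apply/matrixP => i j; rewrite !ord1 !mxE eqxx mulr1n.
have ek2 : y^t* = x 0 0 *: k0^t*.
  by rewrite ek linearZ /= map_mxZ /= xC.
have TX : T *m block_mx x (y^t*) y X *m T^t*
    = block_mx x 0 0 (X - x 0 0 *: (k0 *m k0^t*)).
  move: (x 0 0) xE ek ek2 => s -> -> ->.
  rewrite tr_block_mx map_block_mx !mulmx_block trmx0 map_mx0 !trmx1 !map_mx1.
  rewrite !(mulmx0, mul0mx, mulmx1, mul1mx, addr0, add0r).
  rewrite linearN /= map_mxN !mulNmx !mulmxN mul_mx_scalar mul_scalar_mx.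
  rewrite -!scalemxAr !addNr mul0mx oppr0 add0r; congr block_mx.
  by rewrite addrC.
apply: (hpsd_congr Tu); rewrite TX.
have := lyap_congr Tu eqn; rewrite TX iT !mulmx_block mul_block_col.
rewrite !(mulmx1, mul1mx, mul0mx, mulmx0, addr0, add0r).
rewrite !tr_block_mx tr_col_mx map_row_mx map_block_mx !mulmx_block mul_col_row.
rewrite !add_block_mx trmx0 map_mx0 !(mulmx0, mul0mx, addr0, add0r).
rewrite -[in X in X -> _]block_mx0 => /eq_block_mx [_ _ _ e22'].
have pX : hpsd (X - x 0 0 *: (k0 *m k0^t*)).
  apply: IH e22' => //.
  rewrite linearB /= map_mxB hX linearZ /= map_mxZ /= xC; congr (_ - _ *: _).
  by rewrite hconjM hconjK.
move=> z; rewrite -(vsubmxK z) tr_col_mx map_row_mx mul_row_block.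
rewrite !(mulmx0, addr0, add0r) mul_row_col mx_addE addr_ge0 //.
move: (usubmx z) => u; rewrite !mxE !big_ord1 !mxE !big_ord1 !mxE.
by rewrite mulrAC mulr_ge0 // mulrC mul_conjC_ge0.
Qed.

(** A unitary change of basis makes [A] triangular, with its eigenvalues on the diagonal. *)
Lemma lyap_hpsd n k (A X : 'M[C]_n) (G : 'M[C]_(n, k)) :
  (forall z, eigenvalue A z -> z + z^* < 0) -> X^t* = X ->
  A *m X + X *m A^t* + G *m G^t* = 0 -> hpsd X.
Proof.
move=> stA hX eqn.
have [|P Pu /=] := @cotrigonalization _ _ [:: A].
  by move=> ? ? /=; rewrite !in_cons !orbF => /eqP-> /eqP->.
rewrite andbT => tA; have Pi := unitarymx_unit Pu.
have {}tA : is_trig_mx (P *m A *m invmx P) by rewrite -conjumx.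
apply: (hpsd_congr Pi); apply: (lyap_psd_trig tA) (lyap_congr Pi eqn).
  move=> i; apply: stA; rewrite eigenvalue_root_char.
  rewrite -eigenvalue_root_char -(eigenvalue_similar A _ Pi).
  rewrite eigenvalue_root_char char_poly_trig // /root horner_prod (bigD1 i) //=.
  by rewrite hornerXsubC subrr mul0r.
by rewrite !hconjM hconjK hX mulmxA.
Qed.

(** Without source term both [X] and [- X] are positive semidefinite, so the quadratic form of [X]
    vanishes, and polarization recovers the entries. *)
Lemma lyap_herm_eq0 n (A X : 'M[C]_n) :
  (forall z, eigenvalue A z -> z + z^* < 0) -> X^t* = X ->
  A *m X + X *m A^t* = 0 -> X = 0.
Proof.
move=> stA hX eqn.
have eq0 (Y : 'M[C]_n) : A *m Y + Y *m A^t* = 0 ->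
    A *m Y + Y *m A^t* + (0 : 'M[C]_(n, 1)) *m 0^t* = 0.
  by move=> ->; rewrite mul0mx addr0.
have pX := lyap_hpsd stA hX (eq0 _ eqn).
have nX : hpsd (- X).
  apply: lyap_hpsd (eq0 _ _) => //; first by rewrite linearN /= map_mxN hX.
  by rewrite mulmxN mulNmx -opprD eqn oppr0.
have X0 (x : 'cV[C]_n) : (x^t* *m X *m x) 0 0 = 0.
  apply/eqP; rewrite eq_le pX andbT.
  by have := nX x; rewrite mulmxN mulNmx mx_oppE oppr_ge0.
have Xij i j c : X i i + c^* * c * X j j + c * X i j + c^* * X j i = 0.
  have := X0 (delta_mx i 0 + c *: delta_mx j 0).
  rewrite hconjD hconjZ !trmx_delta !map_delta_mx.
  rewrite !(mulmxDl, mulmxDr) -?scalemxAl -?scalemxAr -?scalemxAl -!rowE -!colE.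
  by rewrite !mxE => <-; ring.
apply/matrixP => i j; rewrite mxE.
have Xd l : X l l = 0.
  by have := Xij l l 0; rewrite conjC0 !mul0r !addr0.
(* The coefficient 1 gives [X i j + X j i], the imaginary unit gives [X i j - X j i]. *)
have := Xij i j 1; have := Xij i j 'i.
rewrite !Xd conjCi conjC1 !mulr0 !add0r !mul1r mulNr -mulrBr => /eqP.
rewrite mulf_eq0 (negPf (neq0Ci _)) /= subr_eq0 => /eqP <- /eqP.
by rewrite -mulr2n mulrn_eq0 => /eqP.
Qed.

End PsdLyapunov.

(** * Transfer to real matrices *)

Section RealLyapunov.
Variable R : realType.
Local Notation C := (R[i]).
Local Notation cplx := (map_mx (real_complex R)).

Lemma conj_real_complex (x : R) : ((x%:C)^* = x%:C)%C.
Proof. by rewrite /= oppr0. Qed.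

Lemma addr_conj_complex (z : C) : z + (z^*)%C = (2 * complex.Re z)%:C%C.
Proof.
apply/eqP; case: z => x y; rewrite eq_complex /=.
by apply/andP; split; apply/eqP; ring.
Qed.

Lemma hconj_cplx m n (A : 'M[R]_(m, n)) : map_mx (@Num.conj C) (cplx A)^T = cplx A^T.
Proof. by apply/matrixP => i j; rewrite !mxE -[RHS]conj_real_complex. Qed.

Lemma stable_conj n (A : 'M[R]_n) : stable A ->
  forall z, eigenvalue (cplx A) z -> z + z^* < 0.
Proof.
move=> stA z /stA zlt0; rewrite [z^*]/(_^*)%C addr_conj_complex.
by rewrite ltcR pmulr_rlt0.
Qed.

Lemma stable_lyap_psd n k (A X : 'M[R]_n) (G : 'M[R]_(n, k)) (x : 'cV[R]_n) :
  stable A -> X^T = X -> A *m X + X *m A^T + G *m G^T = 0 ->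
  0 <= (x^T *m X *m x) 0 0.
Proof.
move=> stA hX /(congr1 (fun M => cplx M)).
rewrite !map_mxD !map_mxM map_mx0 -!hconj_cplx => eqn.
have := lyap_hpsd (stable_conj stA) _ eqn; rewrite hconj_cplx hX.
by move=> /(_ erefl (cplx x)); rewrite hconj_cplx -!map_mxM mxE lecR.
Qed.

End RealLyapunov.

(** Unique solvability is kept apart from stability: it suffices to determine the matrix chosen by
    [XK], and over a field it is the nonvanishing of a determinant ([lyap_injP]), hence easy to
    follow along a line of controllers. *)
Definition lyap_inj (R : pzRingType) n (A : 'M[R]_n) :=
  forall X : 'M[R]_n, A *m X + X *m A^T = 0 -> X = 0.

Lemma stable_lyap_inj (R : realType) n (A : 'M[R]_n) : stable A -> lyap_inj A.
Proof.
move=> stA X eqn.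
have eqnT : A *m X^T + X^T *m A^T = 0.
  by move/(congr1 trmx): eqn; rewrite linearD /= !trmx_mul trmxK linear0 addrC.
(* A real solution need not be symmetric. [Y] packs its symmetric and antisymmetric parts, as real
   and imaginary parts, into one Hermitian solution. *)
pose f := real_complex R; pose Y := map_mx f (X + X^T) + 'i%C *: map_mx f (X - X^T).
have Y0 : Y = 0.
  apply: (lyap_herm_eq0 (stable_conj stA)).
    apply/matrixP => i j; apply/eqP; rewrite !mxE eq_complex /=.
    by apply/andP; split; apply/eqP; ring.
  rewrite hconj_cplx mulmxDr mulmxDl -scalemxAr -scalemxAl addrACA -scalerDr.
  rewrite -!map_mxM -!map_mxD !(mulmxDl, mulmxDr, mulNmx, mulmxN) addrACA eqn eqnT.
  by rewrite addr0 map_mx0 add0r addrACA eqn -opprD eqnT subr0 map_mx0 scaler0.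
apply/matrixP => i j; rewrite mxE.
have := congr1 (fun M : 'M[R[i]]_n => complex.Re (M i j)) Y0.
have := congr1 (fun M : 'M[R[i]]_n => complex.Im (M i j)) Y0.
by rewrite !mxE /= => h1 h2; lra.
Qed.

Section LyapunovOperator.
Variables (F : fieldType) (n : nat).
Implicit Types A X Q : 'M[F]_n.

Lemma lyap_inj_similar (T A B : 'M[F]_n) : T \in unitmx -> B *m T = T *m A ->
  lyap_inj A -> lyap_inj B.
Proof.
move=> Tu BT iA X eqn; have BE : B = T *m A *m invmx T by rewrite -BT mulmxK.
have TTu : T^T \in unitmx by rewrite unitmx_tr.
have : invmx T *m X *m invmx T^T = 0.
  apply: iA; move/(congr1 (fun M => invmx T *m M *m invmx T^T)): eqn.
  rewrite mulmx0 mul0mx BE !trmx_mul trmx_inv !(mulmxDr, mulmxDl) !mulmxA.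
  by rewrite mulVmx // mul1mx mulmxK.
move/(congr1 (fun M => T *m M *m T^T)).
by rewrite mulmx0 mul0mx !mulmxA mulmxV // mul1mx mulmxKV.
Qed.

Lemma lyap_unique A Q X Y : lyap_inj A ->
  A *m X + X *m A^T + Q = 0 -> A *m Y + Y *m A^T + Q = 0 -> X = Y.
Proof.
move=> iA eX eY; apply/eqP; rewrite -subr_eq0; apply/eqP/iA.
transitivity ((A *m X + X *m A^T + Q) - (A *m Y + Y *m A^T + Q)).
  by rewrite mulmxBr mulmxBl; mxring.
by rewrite eX eY subrr.
Qed.

End LyapunovOperator.

Section LyapunovMatrix.
Variables (F : comNzRingType) (n : nat).
Implicit Types A X Q : 'M[F]_n.

Definition lyap_mx A : 'M[F]_(n * n) := lin_mulmx A + lin_mulmxr A^T.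

Lemma mul_lyap_mx A X : mxvec X *m lyap_mx A = mxvec (A *m X + X *m A^T).
Proof. by rewrite mulmxDr !mul_vec_lin -linearD. Qed.

End LyapunovMatrix.

Section LyapunovSolve.
Variables (F : fieldType) (n : nat).
Implicit Types A X Q : 'M[F]_n.

Lemma lyap_injP A : reflect (lyap_inj A) (lyap_mx A \in unitmx).
Proof.
rewrite -row_free_unit; apply: (iffP idP) => [fA X eqn | iA].
  apply: (can_inj mxvecK); rewrite linear0; apply: (row_free_inj fA).
  by rewrite mul_lyap_mx eqn mul0mx linear0.
rewrite -kermx_eq0; apply/eqP/row_matrixP => i; rewrite row0.
have : row i (kermx (lyap_mx A)) *m lyap_mx A = 0 by rewrite -row_mul mulmx_ker row0.
rewrite -[row i _]vec_mxK mul_lyap_mx => /(congr1 vec_mx).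
by rewrite mxvecK linear0 => /iA ->; rewrite linear0.
Qed.

Definition lyap_solve A Q : 'M[F]_n := - vec_mx (mxvec Q *m invmx (lyap_mx A)).

Lemma lyap_solveP A Q : lyap_mx A \in unitmx ->
  A *m lyap_solve A Q + lyap_solve A Q *m A^T + Q = 0.
Proof.
move=> Au; apply: (can_inj mxvecK); rewrite linearD /= -mul_lyap_mx.
by rewrite linearN /= vec_mxK mulNmx mulmxKV // addNr linear0.
Qed.

End LyapunovSolve.

(** * Excess cost over the optimal controller *)

Lemma eigenvalue_lblock (F : fieldType) n1 n2 (A : 'M[F]_n1) B (D : 'M[F]_n2) z :
  eigenvalue (block_mx A 0 B D) z -> eigenvalue A z \/ eigenvalue D z.
Proof.
case/eigenvalueP => v; rewrite -(hsubmxK v); move: (lsubmx v) (rsubmx v) => v1 v2.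
rewrite mul_row_block mulmx0 add0r scale_row_mx => /eq_row_mx [e1 e2] vn0.
have [v20|v2n0] := eqVneq v2 0; last by right; apply/eigenvalueP; exists v2.
left; apply/eigenvalueP; exists v1; first by rewrite -e1 v20 mul0mx addr0.
by apply: contraNneq vn0 => ->; rewrite v20 row_mx0.
Qed.

Lemma stable_lblock (R : realType) n1 n2 (A : 'M[R]_n1) B (D : 'M[R]_n2) :
  stable A -> stable D -> stable (block_mx A 0 B D).
Proof.
by move=> sA sD z; rewrite map_block_mx map_mx0 => /eigenvalue_lblock [/sA|/sD].
Qed.

Lemma stable_similar (R : realType) n (T A B : 'M[R]_n) : T \in unitmx ->
  B *m T = T *m A -> stable A -> stable B.
Proof.
move=> Tu BT sA z; have -> : B = T *m A *m invmx T by rewrite -BT mulmxK.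
by rewrite !map_mxM map_invmx eigenvalue_similar ?map_unitmx // => /sA.
Qed.

Section ControllerBlocks.
Variables (R : realType) (n m p : nat).
Implicit Types K D : 'M[R]_(m + n, p + n).

Lemma CK_addZ K D t : CK (K + t *: D) = CK K + t *: CK D.
Proof. by apply/matrixP => i j; rewrite !mxE. Qed.

Lemma BK_addZ K D t : BK (K + t *: D) = BK K + t *: BK D.
Proof. by apply/matrixP => i j; rewrite !mxE. Qed.

Lemma AK_addZ K D t : AK (K + t *: D) = AK K + t *: AK D.
Proof. by apply/matrixP => i j; rewrite !mxE. Qed.

Lemma CK_block (U : 'M[R]_(m, p)) c b a : @CK R n m p (block_mx U c b a) = c.
Proof. exact: block_mxKur. Qed.

Lemma BK_block (U : 'M[R]_(m, p)) c b a : @BK R n m p (block_mx U c b a) = b.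
Proof. exact: block_mxKdl. Qed.

Lemma AK_block (U : 'M[R]_(m, p)) c b a : @AK R n m p (block_mx U c b a) = a.
Proof. exact: block_mxKdr. Qed.

Lemma CK0 : CK (0 : 'M[R]_(m + n, p + n)) = 0.
Proof. by apply/matrixP => i j; rewrite !mxE. Qed.

Lemma BK0 : BK (0 : 'M[R]_(m + n, p + n)) = 0.
Proof. by apply/matrixP => i j; rewrite !mxE. Qed.

Lemma AK0 : AK (0 : 'M[R]_(m + n, p + n)) = 0.
Proof. by apply/matrixP => i j; rewrite !mxE. Qed.

End ControllerBlocks.

(** With unit weights, the quadratic terms [M B B^T M] and [S C^T C S] of the control and filter
    Riccati equations appear as [F^T F] and [G G^T]. *)
Record riccati (R : realType) (n m p : nat) (P : lqg R n m p)
    (F : 'M[R]_(m, n)) (G : 'M[R]_(n, p)) (M S : 'M[R]_n) : Prop := Riccati {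
  ric_costR : costR P = 1%:M;
  ric_noiseV : noiseV P = 1%:M;
  ric_symM : M^T = M;
  ric_gainF : (plantB P)^T *m M = F;
  ric_eqM : (plantA P)^T *m M + M *m plantA P + costQ P = F^T *m F;
  ric_symS : S^T = S;
  ric_gainG : S *m (plantC P)^T = G;
  ric_eqS : plantA P *m S + S *m (plantA P)^T + noiseW P = G *m G^T }.

(** * Completion of squares and optimality *)

Section RiccatiCompletion.
Variables (R : realType) (n m p : nat) (P : lqg R n m p).
Local Notation A := (plantA P).
Local Notation B := (plantB P).
Local Notation C := (plantC P).
Local Notation Q := (costQ P).
Local Notation W := (noiseW P).
Variables (F : 'M[R]_(m, n)) (G : 'M[R]_(n, p)) (M S : 'M[R]_n).
Hypothesis ric : riccati P F G M S.

Let jmin : R := \tr (M *m W) + \tr (F *m S *m F^T).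

(* [X = Z + diag(S, 0)] for the solution [X] of the Lyapunov equation of the cost,
   and the last trace is the squared H2 norm of the excess system. *)
Lemma J_excess (K : 'M[R]_(m + n, p + n)) (Z : 'M[R]_(n + n)) :
  lyap_inj (Acl P K) ->
  Acl P K *m Z + Z *m (Acl P K)^T
    + col_mx G (BK K) *m (col_mx G (BK K))^T = 0 ->
  J P K = jmin + \tr (row_mx F (CK K) *m Z *m (row_mx F (CK K))^T).
Proof.
case: ric => R1 V1 MT FE ricM ST GE ricS iA eZ; pose X := Z + block_mx S 0 0 0.
have BSC : S *m C^T *m (BK K)^T = G *m (BK K)^T by rewrite GE.
have GT : G^T = C *m S by rewrite -GE trmx_mul trmxK ST.
have eX : Acl P K *m X + X *m (Acl P K)^T + noise_mx P K = 0.
  rewrite -eZ /X mulmxDr mulmxDl /noise_mx V1 mulmx1.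
  rewrite tr_col_mx mul_col_row /Acl tr_block_mx !mulmx_block !(mul0mx, mulmx0, addr0).
  set U := block_mx A _ _ _; set U' := block_mx A^T _ _ _.
  have -> : block_mx (G *m G^T) (G *m (BK K)^T) (BK K *m G^T) (BK K *m (BK K)^T)
     = block_mx (A *m S) 0 (BK K *m C *m S) 0 +
       block_mx (S *m A^T) (S *m (BK K *m C)^T) 0 0 +
       block_mx W 0 0 (BK K *m (BK K)^T).
    rewrite !add_block_mx !(add0r, addr0) -ricS trmx_mul mulmxA BSC GT.
    by rewrite mulmxA.
  by mxring.
have XE : XK P K = X.
  rewrite /XK; case: xgetP => [Y _ eY|/(_ X) []//].
  exact: lyap_unique iA eY eX.
rewrite /J XE.
have -> : \tr (row_mx F (CK K) *m Z *m (row_mx F (CK K))^T) =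
    \tr (row_mx F (CK K) *m X *m (row_mx F (CK K))^T) - \tr (F *m S *m F^T).
  rewrite -linearB /=; congr (\tr _); rewrite /X mulmxDr mulmxDl.
  rewrite mul_row_block !(mulmx0, addr0) tr_row_mx mul_row_col mul0mx addr0.
  by rewrite addrK.
rewrite /jmin addrACA subrr addr0.
move: eX; clear XE; clearbody X; rewrite /noise_mx V1 mulmx1 -(submxK X).
move: (ulsubmx X) (ursubmx X) (dlsubmx X) (drsubmx X) => X1 X2 X3 X4.
rewrite /Acl /cost_mx tr_block_mx R1 mulmx1 !mulmx_block !add_block_mx.
rewrite !(mulmx0, mul0mx, add0r, addr0) -[in X in X -> _]block_mx0.
case/eq_block_mx => e11 _ _ _; rewrite mxtrace_block tr_row_mx mul_row_block mul_row_col.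
have QE : Q = F^T *m F - A^T *m M - M *m A by rewrite -ricM; mxring.
have MB : M *m B = F^T by rewrite -FE trmx_mul trmxK MT.
(* Pairing the plant block of the Lyapunov equation with [M] completes the square: by the control
   Riccati equation the cost becomes the trace of [X] against [[F, C_K]^T [F, C_K]], plus
   [\tr (M *m W)]. *)
move/(congr1 (fun Y => \tr (M *m Y))): e11; rewrite mulmx0 linear0.
rewrite !trmx_mul !(mulmxDr, mulmxDl) !mulmxA MB !linearD /=.
rewrite QE 2!mulmxBl 2!raddfB /=.
rewrite [\tr (M *m X1 *m _)]mxtrace_mulC mulmxA.
rewrite [\tr (_ *m B^T)]mxtrace_mulC !mulmxA FE.
rewrite [\tr (F^T *m F *m X1)]mxtrace_mulC mulmxA.
rewrite -[F^T *m CK K *m X3]mulmxA [\tr (F^T *m (_ *m _))]mxtrace_mulC.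
rewrite -[_ *m CK K *m X4]mulmxA [\tr ((CK K)^T *m (_ *m _))]mxtrace_mulC.
rewrite [\tr (X1 *m F^T *m F)]mxtrace_mulC mulmxA.
lra.
Qed.


(** The separation principle controller: an observer with gain [G] whose state estimate is fed back
    through [- F]. *)
Definition Kopt : 'M[R]_(m + n, p + n) :=
  block_mx 0 (- F) G (A - B *m F - G *m C).

(* The closed loop along the line [Kopt + t *: D], in the coordinates
   [(eta, xi)] such that the plant state is [t eta + xi] and the controller state
   is [xi]. The scaling by [t] makes the excess cost an explicit multiple of
   [t ^+ 2]. *)
Definition Alin (D : 'M[R]_(m + n, p + n)) (t : R) : 'M[R]_(n + n) :=
  block_mx (A - G *m C - t *: (BK D *m C)) (B *m CK D - BK D *m C - AK D)
    (t *: ((G + t *: BK D) *m C)) (A - B *m F + t *: (BK D *m C + AK D)).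
Definition Glin (D : 'M[R]_(m + n, p + n)) (t : R) : 'M[R]_(n + n, p) :=
  col_mx (- BK D) (G + t *: BK D).
Definition Flin (D : 'M[R]_(m + n, p + n)) : 'M[R]_(m, n + n) := row_mx F (CK D).

(** The passage from [(eta, xi)] to the plant and controller states. It is singular at [t = 0], so
    [Acl_line] is stated as an intertwining relation and [lyap_inj_line] treats [t = 0]
    separately. *)
Let Tlin (t : R) : 'M[R]_(n + n) := block_mx t%:M 1%:M 0 1%:M.

Lemma CK_line D t : CK (Kopt + t *: D) = - F + t *: CK D.
Proof. by rewrite CK_addZ CK_block. Qed.

Lemma BK_line D t : BK (Kopt + t *: D) = G + t *: BK D.
Proof. by rewrite BK_addZ BK_block. Qed.

Lemma AK_line D t : AK (Kopt + t *: D) = A - B *m F - G *m C + t *: AK D.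
Proof. by rewrite AK_addZ AK_block. Qed.

Lemma Acl_line D t : Acl P (Kopt + t *: D) *m Tlin t = Tlin t *m Alin D t.
Proof.
rewrite /Acl CK_line BK_line AK_line !mulmx_block.
rewrite !(mulmx0, mul0mx, add0r, addr0, mulmx1, mul1mx).
rewrite !mul_scalar_mx !mul_mx_scalar; congr block_mx.
- by rewrite (mulmxDl G) -scalemxAl; mxring.
- by rewrite mulmxDr mulmxN -scalemxAr; mxring.
- by rewrite (mulmxDl G) -scalemxAl; mxring.
Qed.

Lemma J_line D t (Z : 'M[R]_(n + n)) : lyap_inj (Acl P (Kopt + t *: D)) ->
  Alin D t *m Z + Z *m (Alin D t)^T + Glin D t *m (Glin D t)^T = 0 ->
  J P (Kopt + t *: D) = jmin + t ^+ 2 * \tr (Flin D *m Z *m (Flin D)^T).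
Proof.
move=> iA eZ.
(* In these coordinates the excess output carries a factor [t], the source of [t ^+ 2] in the
   cost. *)
have hF : row_mx F (CK (Kopt + t *: D)) *m Tlin t = t *: Flin D.
  rewrite CK_line mul_row_block !(mulmx0, addr0, mulmx1) mul_mx_scalar.
  by rewrite addNKr scale_row_mx.
have hG : Tlin t *m Glin D t = col_mx G (BK (Kopt + t *: D)).
  rewrite BK_line mul_block_col !(mul0mx, add0r, mul1mx) mul_scalar_mx scalerN.
  by rewrite addrC addrK.
rewrite (@J_excess _ (Tlin t *m Z *m (Tlin t)^T)) //.
  congr (_ + _); rewrite !mulmxA hF -[_ *m _ *m _^T *m _^T]mulmxA -trmx_mul hF.
  by rewrite linearZ /= -!scalemxAl -scalemxAr scalerA linearZ.
rewrite -hG !mulmxA Acl_line -!mulmxA -trmx_mul Acl_line !trmx_mul.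
move/(congr1 (fun Y => Tlin t *m Y *m (Tlin t)^T)): eZ.
by rewrite !(mulmxDl, mulmxDr) mulmx0 mul0mx !mulmxA => ->.
Qed.

Hypotheses (sNo : stable (A - G *m C)) (sNc : stable (A - B *m F)).

(** For [D = 0] and [t = 1] the matrix [Alin] is block triangular with diagonal blocks [A - G C] and
    [A - B F]. *)
Lemma stable_Kopt : stable (Acl P Kopt).
Proof.
have T1u : Tlin 1 \in unitmx by rewrite unitmxE det_ublock !det1 mulr1 unitr1.
have := Acl_line 0 1; rewrite scaler0 addr0 => eT.
apply: (stable_similar T1u eT).
rewrite /Alin BK0 CK0 AK0 !(mul0mx, mulmx0) !(scaler0, addr0) !subr0.
exact: stable_lblock.
Qed.

Lemma lyap_inj_Alin0 D : lyap_inj (Alin D 0).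
Proof.
apply: stable_lyap_inj.
(* At [t = 0] the loop is upper block triangular; exchanging the two halves gives the lower form of
   [stable_lblock]. *)
pose T : 'M[R]_(n + n) := block_mx 0 1%:M 1%:M 0.
have TT : T *m T = 1%:M.
  rewrite mulmx_block !(mulmx0, mul0mx, addr0, add0r, mulmx1).
  by rewrite -scalar_mx_block.
have [Tu _] := mulmx1_unit TT.
apply: (@stable_similar _ _ T (block_mx (A - B *m F) 0
  (B *m CK D - BK D *m C - AK D) (A - G *m C))) => //; last exact: stable_lblock.
rewrite !mulmx_block !(mulmx0, mul0mx, addr0, add0r, mulmx1, mul1mx) !scale0r.
by rewrite subr0 addr0.
Qed.

Lemma lyap_inj_line D t : lyap_inj (Alin D t) -> lyap_inj (Acl P (Kopt + t *: D)).
Proof.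
have [->|t0] := eqVneq t 0; last first.
  apply: lyap_inj_similar (Acl_line D t).
  by rewrite unitmxE det_ublock det1 det_scalar mulr1 unitfE expf_neq0.
by rewrite scale0r addr0 => _; apply/stable_lyap_inj/stable_Kopt.
Qed.

Lemma J_Kopt : J P Kopt = jmin.
Proof.
have i0 := @lyap_inj_Alin0 0.
have := J_line (lyap_inj_line i0) (lyap_solveP _ (introT (lyap_injP _) i0)).
by rewrite scaler0 addr0 expr0n mul0r addr0.
Qed.

Lemma Kopt_optimal : globally_optimal P Kopt.
Proof.
split; first by split; [rewrite /in_Vn /= block_mxKul|exact: stable_Kopt].
move=> K [_ sK]; have iK := stable_lyap_inj sK.
set g := col_mx G (BK K).
have eZ := lyap_solveP (g *m g^T) (introT (lyap_injP _) iK).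
rewrite J_Kopt (J_excess iK eZ) lerDl.
set Z := lyap_solve _ _ in eZ *.
have ZT : Z^T = Z.
  apply: (lyap_unique iK _ eZ); move/(congr1 trmx): eZ.
  by rewrite !linearD /= linear0 !trmx_mul !trmxK [_ *m (Acl P K)^T + _]addrC.
(* The excess cost is the sum of the quadratic form of [Z] over the rows of [[F, C_K]]. *)
rewrite /mxtrace; apply: sumr_ge0 => i _.
have := stable_lyap_psd ((row i (row_mx F (CK K)))^T) sK ZT eZ.
rewrite trmxK -row_mul -[row i _ *m _]row_mul => /le_trans; apply.
by rewrite !mxE le_eqVlt; apply/orP; left; apply/eqP/eq_bigr => k _; rewrite !mxE.
Qed.

End RiccatiCompletion.

(** * The Hessian at the optimal controller *)

Section RationalFunctions.
Variable R : realType.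
Implicit Types (p q : {poly R}) (f : R -> R).

Lemma horner_neq0_near q t : q.[t] != 0 -> \forall s \near t, q.[s] != 0.
Proof.
move=> qt; apply: (@cvgr_neq0 _ _ _ (nbhs t) _ (horner q) q.[t]) => //.
exact: continuous_horner.
Qed.

(** The denominator goes from [q ^+ k] to [q ^+ k.+1], so iterated derivatives keep the same shape.
    The formula for [f] holds only where [q] is nonzero, which is an open condition. *)
Lemma is_derive_rat f p q k t : (forall s, q.[s] != 0 -> f s = p.[s] / q.[s] ^+ k) ->
  q.[t] != 0 ->
  is_derive t 1 f ((p^`() * q - k%:R *: (p * q^`())).[t] / q.[t] ^+ k.+1).
Proof.
move=> fE qt.
apply: (@near_eq_is_derive _ _ _ (fun s => p.[s] * (q.[s] ^+ k)^-1)).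
  by near=> s; rewrite fE //; near: s; exact: horner_neq0_near.
have qkt : (q ^+ k).[t] != 0 by rewrite horner_exp expf_neq0.
have -> : (fun s => p.[s] * (q.[s] ^+ k)^-1) =
    horner p * (fun s => (horner (q ^+ k) s)^-1).
  by apply/funext => s; rewrite fctE horner_exp.
have d2 := is_deriveV qkt (is_derive_poly (q ^+ k) t).
apply: (is_derive_eq (is_deriveM (is_derive_poly p t) d2)).
rewrite /= deriv_exp hornerD hornerN hornerZ hornerMn !hornerM !horner_exp.
rewrite /GRing.scale /= -[(_ * _) *+ k]mulr_natl.
case: k {fE qkt d2} => [|k]; first by rewrite !expr0 expr1; field.
rewrite /= !exprS; field.
by rewrite expf_neq0.
Unshelve. all: by end_near. Qed.

Lemma derive1_rat f p q k t : (forall s, q.[s] != 0 -> f s = p.[s] / q.[s] ^+ k) ->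
  q.[t] != 0 ->
  derive1 f t = (p^`() * q - k%:R *: (p * q^`())).[t] / q.[t] ^+ k.+1.
Proof. by move=> fE qt; rewrite derive1E; have [] := is_derive_rat fE qt. Qed.

Lemma derivable_derive1n_rat f p q k t :
  (forall s, q.[s] != 0 -> f s = p.[s] / q.[s]) -> q.[t] != 0 ->
  derivable (derive1n k f) t 1.
Proof.
move=> fE.
suff [pk hk] : exists pk, forall s, q.[s] != 0 ->
    derive1n k f s = pk.[s] / q.[s] ^+ k.+1.
  by move=> qt; have [] := is_derive_rat hk qt.
elim: k => [|k [pk IH]]; first by exists p => s qs; rewrite derive1n0 expr1 fE.
eexists => s qs; rewrite derive1nS; exact: (derive1_rat IH qs).
Qed.

Lemma derive1n2_rat f p q c : (forall s, q.[s] != 0 -> f s = c + s ^+ 2 * (p.[s] / q.[s])) ->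
  q.[0] != 0 -> derive1n 2 f 0 = 2 * (p.[0] / q.[0]).
Proof.
move=> fE q0.
have fE1 s : q.[s] != 0 -> f s = (c *: q + 'X ^+ 2 * p).[s] / q.[s] ^+ 1.
  by move=> qs; rewrite fE // hornerD hornerZ hornerM hornerXn expr1; field.
have fE2 s := derive1_rat fE1 (t := s).
rewrite derive1nS derive1n1 (derive1_rat fE2 q0).
rewrite !(derivD, derivN, derivZ, derivM, derivXn, derivX) !scale1r.
rewrite !(hornerD, hornerN, hornerZ, hornerM, hornerMn, hornerXn, hornerX).
by rewrite !(mulr0n, mulr1n, expr0n, expr1n, mul0r, mulr0) /=; field.
Qed.

End RationalFunctions.

(** The difference quotients of [f] along [v] and of its restriction to the line are the same
    functions, so the Hessian of [J] becomes a second derivative in one variable. *)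
Lemma derive_derive_line (R : realType) (V : normedModType R) (f : V -> R) (x v : V) :
  'D_v (fun y => 'D_v f y) x = derive1n 2 (fun t => f (x + t *: v)) 0.
Proof.
have shiftE h t : h *: v + (x + t *: v) = x + (h + t) *: v.
  by rewrite scalerDl addrCA.
have e1 (g : V -> R) t : 'D_v g (x + t *: v) = derive1 (fun t => g (x + t *: v)) t.
  rewrite /derive /derive1; set F := (F in F @ _); set G := (G in _ = lim (G @ _)).
  by have -> : F = G by apply/funext => h; rewrite /F /G /= shiftE.
rewrite derive1nS derive1n1.
have -> : derive1 (fun t => f (x + t *: v)) = (fun t => 'D_v f (x + t *: v)).
  by apply/funext => t; rewrite e1.
by rewrite -(e1 (fun y => 'D_v f y)) scale0r addr0.
Qed.

Section PolynomialMatrices.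
Variable R : comNzRingType.

(** Determinants, adjugates and traces commute with evaluation of one polynomial matrix, so
    rationality in [t] follows without any expansion. *)
Definition polymx m n (f : R -> 'M[R]_(m, n)) :=
  exists P : 'M[{poly R}]_(m, n), forall t, f t = map_mx (horner_eval t) P.

Lemma polymx_cst m n (A : 'M[R]_(m, n)) : polymx (fun=> A).
Proof.
by exists (map_mx polyC A) => t; apply/matrixP => i j; rewrite !mxE horner_evalE hornerC.
Qed.

Lemma polymxD m n (f g : R -> 'M[R]_(m, n)) :
  polymx f -> polymx g -> polymx (fun t => f t + g t).
Proof.
by move=> [P fE] [Q gE]; exists (P + Q) => t; rewrite map_mxD fE gE.
Qed.

Lemma polymxN m n (f : R -> 'M[R]_(m, n)) : polymx f -> polymx (fun t => - f t).
Proof. by move=> [P fE]; exists (- P) => t; rewrite map_mxN fE. Qed.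

Lemma polymxM m n p (f : R -> 'M[R]_(m, n)) (g : R -> 'M[R]_(n, p)) :
  polymx f -> polymx g -> polymx (fun t => f t *m g t).
Proof.
by move=> [P fE] [Q gE]; exists (P *m Q) => t; rewrite map_mxM fE gE.
Qed.

Lemma polymxT m n (f : R -> 'M[R]_(m, n)) : polymx f -> polymx (fun t => (f t)^T).
Proof. by move=> [P fE]; exists P^T => t; rewrite -map_trmx fE. Qed.

Lemma polymxZ m n (f : R -> 'M[R]_(m, n)) : polymx f -> polymx (fun t => t *: f t).
Proof.
move=> [P fE]; exists ('X *: P) => t.
by rewrite fE map_mxZ /= horner_evalE hornerX.
Qed.

Lemma polymx_block m1 m2 n1 n2 (a : R -> 'M[R]_(m1, n1)) (b : R -> 'M[R]_(m1, n2))
    (c : R -> 'M[R]_(m2, n1)) (d : R -> 'M[R]_(m2, n2)) :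
  polymx a -> polymx b -> polymx c -> polymx d ->
  polymx (fun t => block_mx (a t) (b t) (c t) (d t)).
Proof.
move=> [P aE] [Q bE] [S cE] [T dE]; exists (block_mx P Q S T) => t.
by rewrite map_block_mx aE bE cE dE.
Qed.

Lemma polymx_lyap n (f : R -> 'M[R]_n) : polymx f -> polymx (fun t => lyap_mx (f t)).
Proof.
move=> [P fE]; exists (lyap_mx P) => t; rewrite fE map_mxD; congr (_ + _).
  by symmetry; apply: map_lin_mx => A /=; rewrite map_mxM.
by symmetry; apply: map_lin_mx => A /=; rewrite map_mxM -map_trmx.
Qed.

Lemma polymx_mxvec m n (f : R -> 'M[R]_(m, n)) : polymx f -> polymx (fun t => mxvec (f t)).
Proof. by move=> [P fE]; exists (mxvec P) => t; rewrite map_mxvec fE. Qed.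

Lemma polymx_vec_mx m n (f : R -> 'rV[R]_(m * n)) : polymx f -> polymx (fun t => vec_mx (f t)).
Proof. by move=> [P fE]; exists (vec_mx P) => t; rewrite map_vec_mx fE. Qed.

Lemma polymx_adj n (f : R -> 'M[R]_n) : polymx f -> polymx (fun t => \adj (f t)).
Proof. by move=> [P fE]; exists (\adj P) => t; rewrite map_mx_adj fE. Qed.

Lemma polymx_det n (f : R -> 'M[R]_n) : polymx f ->
  exists q : {poly R}, forall t, \det (f t) = q.[t].
Proof. by move=> [P fE]; exists (\det P) => t; rewrite fE det_map_mx. Qed.

Lemma polymx_tr n (f : R -> 'M[R]_n) : polymx f ->
  exists q : {poly R}, forall t, \tr (f t) = q.[t].
Proof. by move=> [P fE]; exists (\tr P) => t; rewrite fE trace_map_mx. Qed.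

End PolynomialMatrices.

(** * Second derivative of the cost along a line *)

Section HessianLine.
Variables (R : realType) (n m p : nat) (P : lqg R n m p).
Variables (F : 'M[R]_(m, n)) (G : 'M[R]_(n, p)).

Lemma polymx_Alin D : polymx (Alin P F G D).
Proof.
apply: polymx_block.
- by apply: polymxD (polymx_cst _) (polymxN (polymxZ (polymx_cst _))).
- exact: polymx_cst.
- apply/polymxZ/polymxM; last exact: polymx_cst.
  by apply: polymxD (polymx_cst _) (polymxZ (polymx_cst _)).
- by apply: polymxD (polymx_cst _) (polymxZ (polymx_cst _)).
Qed.

Lemma polymx_Glin (D : 'M[R]_(m + n, p + n)) : polymx (Glin G D).
Proof.
have [P1 h1] : polymx (fun t => G + t *: BK D).
  by apply: polymxD (polymx_cst _) (polymxZ (polymx_cst _)).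
have [P2 h2] := polymx_cst (- BK D).
by exists (col_mx P2 P1) => t; rewrite map_col_mx -h1 -h2.
Qed.

(** The excess cost on the line is [t ^+ 2] times the trace of a Lyapunov solution. Cramer's rule
    writes that trace as [r / q], with [q] the determinant of the Lyapunov operator, nonzero at 0;
    only the value of [r / q] at 0 survives in the second derivative there. *)
Lemma Hess_Kopt (M S : 'M[R]_n) (D : 'M[R]_(m + n, p + n)) (Z : 'M[R]_(n + n)) :
  riccati P F G M S ->
  stable (plantA P - G *m plantC P) -> stable (plantA P - plantB P *m F) ->
  Alin P F G D 0 *m Z + Z *m (Alin P F G D 0)^T + Glin G D 0 *m (Glin G D 0)^T = 0 ->
  Hess P (Kopt P F G) D D = 2 * \tr (Flin F D *m Z *m (Flin F D)^T).
Proof.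
move=> ric sNo sNc eZ.
have i0 := @lyap_inj_Alin0 _ _ _ _ P F G sNo sNc D.
have pL := polymx_lyap (polymx_Alin D).
have pN : polymx (fun t => Flin F D *m
    vec_mx (mxvec (Glin G D t *m (Glin G D t)^T) *m \adj (lyap_mx (Alin P F G D t)))
    *m (Flin F D)^T).
  have pG := polymx_Glin D.
  apply: polymxM (polymx_cst _); apply: polymxM (polymx_cst _) _.
  by apply/polymx_vec_mx/polymxM; [exact/polymx_mxvec/polymxM/polymxT|exact: polymx_adj].
(* The minus sign in [lyap_solve] is absorbed into [r]. *)
have [q qE] := polymx_det pL; have [r rE] := polymx_tr (polymxN pN).
have solE t : q.[t] != 0 ->
    \tr (Flin F D *m lyap_solve (Alin P F G D t) (Glin G D t *m (Glin G D t)^T)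
      *m (Flin F D)^T) = r.[t] / q.[t].
  move=> qt; rewrite -rE -qE /lyap_solve /invmx unitmxE unitfE qE qt.
  rewrite -scalemxAr linearZ /= mulmxN mulNmx -scalemxAr -scalemxAl.
  by rewrite !raddfN /= mxtraceZ; ring.
have unitE t : q.[t] != 0 -> lyap_mx (Alin P F G D t) \in unitmx.
  by rewrite unitmxE unitfE qE.
have q0 : q.[0] != 0.
  by rewrite -qE -unitfE -unitmxE; apply/lyap_injP.
rewrite /Hess derive_derive_line.
rewrite (derive1n2_rat (p := r) (q := q) (c := J P (Kopt P F G))) //.
  rewrite -solE //; congr (2 * \tr (_ *m _ *m _)).
  exact: (lyap_unique i0 (lyap_solveP _ (unitE _ q0)) eZ).
move=> t qt; have it := elimT (lyap_injP _) (unitE t qt).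
rewrite (J_line ric (lyap_inj_line sNo sNc it) (lyap_solveP _ (unitE t qt))).
by rewrite solE // (J_Kopt ric).
Qed.

End HessianLine.

(** * Tangent space of the orbit *)

Section MatrixCurves.
Variable R : realType.

Definition mxderiv m n (f : R -> 'M[R]_(m, n)) (f' : 'M[R]_(m, n)) :=
  forall i j, is_derive (0 : R) 1 (fun t => f t i j) (f' i j).

Lemma mxderiv_unique m n (f : R -> 'M[R]_(m, n)) A B :
  mxderiv f A -> mxderiv f B -> A = B.
Proof.
move=> fA fB; apply/matrixP => i j.
by have [_ <-] := fA i j; have [_ <-] := fB i j.
Qed.

Lemma near_mxderiv m n (f g : R -> 'M[R]_(m, n)) A :
  (\forall t \near (0 : R), f t = g t) -> mxderiv f A -> mxderiv g A.
Proof.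
move=> fg fA i j; apply: near_eq_is_derive (fA i j).
by near=> t; have -> : f t = g t by near: t.
Unshelve. all: by end_near. Qed.

Lemma mxderiv_cst m n (A : 'M[R]_(m, n)) : mxderiv (fun=> A) 0.
Proof. by move=> i j; rewrite mxE; exact: is_derive_cst. Qed.

Lemma mxderivM m n p (f : R -> 'M[R]_(m, n)) (g : R -> 'M[R]_(n, p)) A B :
  mxderiv f A -> mxderiv g B ->
  mxderiv (fun t => f t *m g t) (A *m g 0 + f 0 *m B).
Proof.
move=> fA gB i j.
have -> : (fun t => (f t *m g t) i j) =
    \sum_(k < n) ((fun t => f t i k) * (fun t => g t k j)).
  apply/funext => t; rewrite mxE fct_sumE; exact: eq_bigr.
have h k := is_deriveM (fA i k) (gB k j).
apply: (is_derive_eq (is_derive_sum h)).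
rewrite !mxE -big_split /=; apply: eq_bigr => k _.
by rewrite /GRing.scale /= addrC [A i k * _]mulrC.
Qed.

Lemma mxderiv_sub m n m' n' (f : R -> 'M[R]_(m, n)) A (r : 'I_m' -> 'I_m) (s : 'I_n' -> 'I_n)
    (g : 'M[R]_(m, n) -> 'M[R]_(m', n')) :
  (forall M i j, g M i j = M (r i) (s j)) ->
  mxderiv f A -> mxderiv (fun t => g (f t)) (g A).
Proof.
move=> gE fA i j; rewrite gE.
by have -> : (fun t => g (f t) i j) = (fun t => f t (r i) (s j)) by apply/funext => t.
Qed.

Definition mxderivable m n (f : R -> 'M[R]_(m, n)) := exists A, mxderiv f A.

Lemma mxderivableP m n (f : R -> 'M[R]_(m, n)) :
  (forall i j, derivable (fun t => f t i j) 0 1) -> mxderivable f.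
Proof.
move=> df; exists (\matrix_(i, j) 'D_1 (fun t => f t i j) 0) => i j.
by rewrite mxE; apply: DeriveDef.
Qed.

Lemma mxderivableM m n p (f : R -> 'M[R]_(m, n)) (g : R -> 'M[R]_(n, p)) :
  mxderivable f -> mxderivable g -> mxderivable (fun t => f t *m g t).
Proof. by move=> [A fA] [B gB]; eexists; exact: mxderivM fA gB. Qed.

Lemma mxderivable_exp n (f : R -> 'M[R]_n) k : mxderivable f ->
  mxderivable (fun t => f t ^+ k).
Proof.
move=> df; elim: k => [|k IH]; first by exists 0; exact: mxderiv_cst.
suff -> : (fun t => f t ^+ k.+1) = (fun t => f t *m f t ^+ k) by exact: mxderivableM.
by apply/funext => t; rewrite exprS.
Qed.

Lemma mxderivable_mxrow m q (p_ : 'I_q -> nat) (f : R -> forall k, 'M[R]_(m, p_ k)) :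
  (forall k, mxderivable (fun t => f t k)) ->
  mxderivable (fun t => \mxrow_k f t k).
Proof.
move=> df; apply: mxderivableP => i j.
have [A fA] := df (tagnat.sig1 j); have [h _] := fA i (tagnat.sig2 j).
rewrite (_ : (fun t => _) = fun t => f t (tagnat.sig1 j) i (tagnat.sig2 j)) //.
by apply/funext => t; rewrite mxE.
Qed.

End MatrixCurves.

Section OrbitTangent.
Variables (R : realType) (n m p : nat).
Implicit Types K D : 'M[R]_(m + n, p + n).

(* The velocity at [T = 1] of the conjugates of [K] when [T] has velocity [S]. *)
Definition tangent K (S : 'M[R]_n) : 'M[R]_(m + n, p + n) :=
  block_mx 0 (- (CK K *m S)) (S *m BK K) (S *m AK K - AK K *m S).

Lemma ctrl_blockE K : in_Vn K -> K = block_mx 0 (CK K) (BK K) (AK K).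
Proof. by move=> K0; rewrite -[LHS]submxK (K0 : ulsubmx K = 0). Qed.

(** The orbit relations are multiplied out by [T t], so the product rule gives the velocity without
    differentiating an inverse. *)
Lemma orbit_velocity (c : R -> 'M[R]_(m + n, p + n)) (T : R -> 'M[R]_n) K D S :
  mxderiv c D -> mxderiv T S -> c 0 = K -> T 0 = 1%:M ->
  (\forall t \near (0 : R), [/\ in_Vn (c t), CK (c t) *m T t = CK K,
      BK (c t) = T t *m BK K & AK (c t) *m T t = T t *m AK K]) ->
  D = tangent K S.
Proof.
move=> cD TS c0 T0 H.
have dU : mxderiv (fun t => ulsubmx (c t)) (ulsubmx D).
  by apply: (mxderiv_sub (r := lshift n) (s := lshift n)) cD => M i j; rewrite !mxE.
have dC : mxderiv (fun t => CK (c t)) (CK D).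
  by apply: (mxderiv_sub (r := lshift n) (s := @rshift p n)) cD => M i j; rewrite !mxE.
have dB : mxderiv (fun t => BK (c t)) (BK D).
  by apply: (mxderiv_sub (r := @rshift m n) (s := lshift n)) cD => M i j; rewrite !mxE.
have dA : mxderiv (fun t => AK (c t)) (AK D).
  by apply: (mxderiv_sub (r := @rshift m n) (s := @rshift p n)) cD => M i j; rewrite !mxE.
have U0 : ulsubmx D = 0.
  apply: (mxderiv_unique dU); apply: near_mxderiv (mxderiv_cst _).
  by apply: filterS H => t [+ _ _ _]; rewrite /in_Vn /= => ->.
have C0 : CK D = - (CK K *m S).
  have : CK D *m T 0 + CK (c 0) *m S = 0.
    apply: (mxderiv_unique (mxderivM dC TS)); apply: near_mxderiv (mxderiv_cst (CK K)).
    by apply: filterS H => t [_ ->].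
  by rewrite c0 T0 mulmx1 => /eqP; rewrite addr_eq0 => /eqP.
have B0 : BK D = S *m BK K.
  apply: (mxderiv_unique dB).
  have := mxderivM TS (mxderiv_cst (BK K)); rewrite mulmx0 addr0.
  by apply: near_mxderiv; apply: filterS H => t [_ _ ->].
have A0 : AK D = S *m AK K - AK K *m S.
  have : AK D *m T 0 + AK (c 0) *m S = S *m AK K.
    apply: (mxderiv_unique (mxderivM dA TS)).
    have := mxderivM TS (mxderiv_cst (AK K)); rewrite mulmx0 addr0.
    by apply: near_mxderiv; apply: filterS H => t [_ _ _ ->].
  by rewrite c0 T0 mulmx1 => <-; rewrite addrK.
by rewrite /tangent -C0 -B0 -A0 -U0 -[LHS]submxK.
Qed.

(** The orbit supplies a matrix [T] at each time separately, with no regularity. Controllability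
    recovers it: the controllability matrix of [c t] is [T] times that of [K], so a right inverse
    [M0] of the latter shows that [T] is differentiable in [t]. *)
Lemma TO_tangent K D : controllable (AK K) (BK K) -> TO K D ->
  exists S, D = tangent K S.
Proof.
move=> ctK [c [c0 Hc Dc]].
pose ctrb (L : 'M[R]_(m + n, p + n)) := \mxrow_(i < n) (AK L ^+ i *m BK L).
have [M0 M0E] : exists M0, ctrb K *m M0 = 1%:M.
  by apply/row_freeP; rewrite /row_free ctK.
have cdr : mxderiv c D.
  move=> i j; apply: DeriveDef; last by rewrite -derive1E Dc.
  (* Order 0 of the smoothness condition is the derivability of the entries of [c] themselves. *)
  have [_ /(_ 0%N i j)] := nbhs_singleton Hc; exact.
have dT : mxderivable (fun t => ctrb (c t) *m M0).
  apply: mxderivableM; last by exists 0; exact: mxderiv_cst.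
  apply: mxderivable_mxrow => k; apply: mxderivableM.
    apply: mxderivable_exp; exists (AK D).
    by apply: (mxderiv_sub (r := @rshift m n) (s := @rshift p n)) cdr => M i j; rewrite !mxE.
  exists (BK D).
  by apply: (mxderiv_sub (r := @rshift m n) (s := lshift n)) cdr => M i j; rewrite !mxE.
have [S TS] := dT; exists S.
apply: (orbit_velocity cdr TS c0); first by rewrite c0.
apply: filterS Hc => t [[T Tu ctE] _].
have AE : AK (c t) *m T = T *m AK K by rewrite ctE AK_block mulmxKV.
have BE : BK (c t) = T *m BK K by rewrite ctE BK_block.
have -> : ctrb (c t) *m M0 = T.
  rewrite -[RHS]mulmx1 -M0E mulmxA; congr (_ *m _).
  rewrite /ctrb mul_mxrow; apply: eq_mxrow => i.
  rewrite BE !mulmxA; congr (_ *m _); elim: (nat_of_ord i) => [|k IH].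
    by rewrite !expr0 mul1mx mulmx1.
  by rewrite !exprSr !mulmxE -mulrA -!mulmxE AE !mulmxA IH.
split=> //; first by rewrite ctE /in_Vn /= block_mxKul.
by rewrite ctE CK_block mulmxKV.
Qed.

Lemma tangent_TO K S : in_Vn K -> TO K (tangent K S).
Proof.
move=> KV; pose T t : 'M[R]_n := 1%:M + t *: S.
have T0 : T 0 = 1%:M by rewrite /T scale0r addr0.
have pT : polymx T by apply: polymxD (polymx_cst _) (polymxZ (polymx_cst _)).
(* [N t] is the conjugate of [K] by [T t = 1 + t S], multiplied by [\det (T t)]. All blocks then
   become polynomial, and the curve is rational, hence smooth near 0. *)
pose N t := block_mx (0 : 'M[R]_(m, p)) (CK K *m \adj (T t))
  (T t *m \adj (T t) *m T t *m BK K) (T t *m AK K *m \adj (T t)).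
have [Q NE] : polymx N.
  apply: polymx_block.
  - exact: polymx_cst.
  - exact: polymxM (polymx_cst _) (polymx_adj pT).
  - exact: polymxM (polymxM (polymxM pT (polymx_adj pT)) pT) (polymx_cst _).
  - exact: polymxM (polymxM pT (polymx_cst _)) (polymx_adj pT).
have [q qE] := polymx_det pT.
have q0 : q.[0] != 0 by rewrite -qE T0 det1 oner_neq0.
pose c t := q.[t]^-1 *: N t.
have cE i j t : q.[t] != 0 -> c t i j = (Q i j).[t] / q.[t].
  by move=> _; rewrite /c mxE NE mxE mulrC.
have cN t : q.[t] != 0 -> c t = block_mx 0 (CK K *m invmx (T t)) (T t *m BK K)
    (T t *m AK K *m invmx (T t)) /\ T t \in unitmx.
  move=> qt; have Tu : T t \in unitmx by rewrite unitmxE unitfE qE.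
  split=> //; rewrite /c /N scale_block_mx scaler0 /invmx Tu -!scalemxAr qE.
  by rewrite mul_mx_adj qE mul_scalar_mx -scalemxAl scalerA mulVf // scale1r.
have nq : \forall t \near (0 : R), q.[t] != 0 := horner_neq0_near q0.
have c0 : c 0 = K.
  by have [-> _] := cN _ q0; rewrite T0 invmx1 !mulmx1 !mul1mx -ctrl_blockE.
have [D cD] : mxderivable c.
  by apply: mxderivableP => i j; apply: (@derivable_derive1n_rat _ _ _ _ 0%N 0 (cE i j)).
have TS : mxderiv T S.
  move=> i j.
  have -> : (fun t => T t i j) = horner (((1%:M : 'M[R]_n) i j)%:P + S i j *: 'X).
    by apply/funext => t; rewrite !mxE !hornerE mulrC.
  apply: is_derive_eq.
  by rewrite derivD derivC derivZ derivX add0r !hornerE.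
have DE : D = tangent K S.
  apply: (orbit_velocity cD TS c0 T0); apply: filterS nq => t /cN [-> Tu].
  by rewrite /in_Vn /= block_mxKul CK_block BK_block AK_block !mulmxKV.
exists c; split => //.
  apply: filterS nq => t qt; split.
    by have [cT Tu] := cN _ qt; exists (T t).
  by move=> k i j; exact: derivable_derive1n_rat (cE i j) qt.
by move=> i j; rewrite derive1E -DE; have [] := cD i j.
Qed.

End OrbitTangent.

(** * Extrema of Rayleigh quotients *)

Section FrobeniusInnerProduct.
Variables (R : realType) (m n : nat).
Implicit Types U D : 'M[R]_(m, n).

Lemma finnerE U D : finner U D = \sum_i \sum_j U i j * D i j.
Proof.
rewrite /finner /mxtrace exchange_big /=; apply: eq_bigr => j _.
by rewrite mxE; apply: eq_bigr => i _; rewrite mxE.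
Qed.

Lemma finnerC U D : finner U D = finner D U.
Proof. by rewrite !finnerE; apply: eq_bigr => i _; apply: eq_bigr => j _; rewrite mulrC. Qed.

Lemma finnerDr U D D' : finner U (D + D') = finner U D + finner U D'.
Proof. by rewrite /finner mulmxDr mxtraceD. Qed.

Lemma finnerZr U a D : finner U (a *: D) = a * finner U D.
Proof. by rewrite /finner -scalemxAr mxtraceZ. Qed.

Lemma finnerBr U D D' : finner U (D - D') = finner U D - finner U D'.
Proof. by rewrite finnerDr -scaleN1r finnerZr mulN1r. Qed.

Lemma finner_ge0 D : 0 <= finner D D.
Proof. by rewrite finnerE; do 2!(apply: sumr_ge0 => ? _); rewrite -expr2 sqr_ge0. Qed.

Lemma ler_finner_coord D i j : D i j ^+ 2 <= finner D D.
Proof.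
rewrite finnerE (bigD1 i) //= (bigD1 j) //= -expr2 -addrA lerDl addr_ge0 //.
  by apply: sumr_ge0 => ? _; rewrite -expr2 sqr_ge0.
by do 2!(apply: sumr_ge0 => ? _); rewrite -expr2 sqr_ge0.
Qed.

Lemma finner_eq0 D : finner D D = 0 -> D = 0.
Proof.
move=> D0; apply/matrixP => i j; rewrite mxE; apply/eqP.
by rewrite -sqrf_eq0 eq_le sqr_ge0 andbT -D0 ler_finner_coord.
Qed.

Lemma fnorm_sqr D : fnorm D ^+ 2 = finner D D.
Proof. by rewrite sqr_sqrtr // finner_ge0. Qed.

Lemma fnorm_ge0 D : 0 <= fnorm D.
Proof. exact: sqrtr_ge0. Qed.

Lemma finner_gt0 D : D != 0 -> 0 < finner D D.
Proof.
by move=> D0; rewrite lt_def finner_ge0 andbT; apply: contra D0 => /eqP/finner_eq0/eqP.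
Qed.

Lemma finner_cauchy U D : finner U D <= fnorm U * fnorm D.
Proof.
have [D0|Dn0] := eqVneq D 0.
  by rewrite D0 -[0](scale0r 0) finnerZr mul0r mulr_ge0 ?fnorm_ge0.
have dd := finner_gt0 Dn0.
rewrite (le_trans (ler_norm _)) // -ler_sqr ?nnegrE ?normr_ge0 ?mulr_ge0 ?fnorm_ge0 //.
rewrite exprMn !fnorm_sqr real_normK ?num_real //.
have := finner_ge0 (finner D D *: U - finner U D *: D).
rewrite finnerBr !finnerZr ![finner (_ - _) _]finnerC !finnerBr !finnerZr [finner D U]finnerC.
have -> : finner D D * (finner D D * finner U U - finner U D * finner U D) -
  finner U D * (finner D D * finner U D - finner U D * finner D D)
  = finner D D * (finner U U * finner D D - finner U D ^+ 2) by ring.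
by rewrite pmulr_rge0 // subr_ge0.
Qed.

End FrobeniusInnerProduct.

(** * Attainment of the extrema by compactness *)

Section RayleighExtrema.
Variables (R : realType) (m n : nat).
Implicit Types D : 'M[R]_(m, n).

Lemma continuous_sumr (T : topologicalType) (I : Type) (r : seq I) (f : I -> T -> R) :
  (forall i, continuous (f i)) -> continuous (fun x => \sum_(i <- r) f i x).
Proof.
move=> cf x; elim: r => [|i r IH].
  by rewrite (_ : (fun _ => _) = cst 0);
    [exact: cst_continuous|apply/funext => y; rewrite big_nil].
rewrite (_ : (fun _ => _) = f i \+ (fun x => \sum_(i <- r) f i x)).
  by apply: continuousD => //; exact: cf.
by apply/funext => y; rewrite big_cons.
Qed.

Definition mxcont (T : topologicalType) m n (f : T -> 'M[R]_(m, n)) :=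
  forall i j, continuous (fun x => f x i j).

Lemma continuous_finner (T : topologicalType) (f g : T -> 'M[R]_(m, n)) :
  mxcont f -> mxcont g -> continuous (fun x => finner (f x) (g x)).
Proof.
move=> cf cg.
rewrite (_ : (fun _ => _) = fun x => \sum_i \sum_j f x i j * g x i j).
  do 2!(apply: continuous_sumr => ?); move=> x.
  by apply: continuousM; [exact: cf|exact: cg].
by apply/funext => x; rewrite finnerE.
Qed.

Lemma mxcont_vec_mx : mxcont (fun x : 'rV[R]_(m * n) => vec_mx x).
Proof.
move=> i j; rewrite (_ : (fun _ => _) = fun x : 'rV_(m * n) => x 0 (mxvec_index i j)).
  exact: coord_continuous.
by apply/funext => x; rewrite mxE.
Qed.

Variables (I : Type) (W : I -> 'M[R]_(m, n)).
Variables (q : 'M[R]_(m, n) -> R) (D0 : 'M[R]_(m, n)).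
Hypotheses (cq : continuous (fun x : 'rV[R]_(m * n) => q (vec_mx x)))
  (qZ : forall a D, q (a *: D) = a ^+ 2 * q D)
  (WD0 : forall i, finner (W i) D0 = 0) (D0n0 : D0 != 0).

Let ray := [set q D / fnorm D ^+ 2 | D in
  [set D | (forall i, finner (W i) D = 0) /\ D != 0]].

(** The unit sphere of the constrained subspace, in row vector coordinates, where the compactness
    criterion and the extreme value theorems apply. *)
Let sph := [set x : 'rV[R]_(m * n) | (forall i, finner (W i) (vec_mx x) = 0) /\
  finner (vec_mx x) (vec_mx x) = 1].

Let sph_compact : compact sph.
Proof.
apply: bounded_closed_compact.
  exists 1; split => // r r1 x [_ x1].
  apply: le_trans (ltW r1).
  (* The norm of row vectors is the largest absolute value of a coordinate, and each coordinate is
     bounded by the Frobenius norm. *)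
  rewrite [leLHS]/Num.norm /= mx_normrE; apply/bigmax_leP; split => // -[i k] _ /=.
  case/mxvec_indexP: k => k l; rewrite (ord1 i).
  have := ler_finner_coord (vec_mx x : 'M[R]_(m, n)) k l; rewrite x1 mxE.
  by rewrite -real_normK ?num_real // expr_le1 ?normr_ge0.
have -> : sph = (\bigcap_i ((fun x => finner (W i) (vec_mx x)) @^-1` [set y | y = 0]))
    `&` ((fun x : 'rV[R]_(m * n) => finner (vec_mx x : 'M[R]_(m, n)) (vec_mx x))
      @^-1` [set y | y = 1]).
  by apply/seteqP; split => x [h1 h2]; split => // i; move=> *; exact: h1.
have clo (f : 'rV[R]_(m * n) -> R) y : continuous f -> closed (f @^-1` [set z | z = y]).
  by move=> /continuous_closedP; apply; exact: closed_eq.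
apply: closedI.
  apply: closed_bigI => i _; apply: clo.
  by apply: continuous_finner; [move=> k l; exact: cst_continuous|exact: mxcont_vec_mx].
by apply: clo; apply: continuous_finner;
  exact: mxcont_vec_mx.
Qed.

Let normalize D : (forall i, finner (W i) D = 0) -> D != 0 ->
  exists2 x, sph x & q (vec_mx x) = q D / fnorm D ^+ 2.
Proof.
move=> WD Dn0; have dd := finner_gt0 Dn0.
have fn0 : fnorm D != 0 by rewrite -sqrf_eq0 fnorm_sqr gt_eqF.
exists (mxvec ((fnorm D)^-1 *: D)); rewrite ?mxvecK.
  split=> [i|]; first by rewrite mxvecK finnerZr WD mulr0.
  rewrite mxvecK finnerZr finnerC finnerZr -fnorm_sqr; field; exact: fn0.
by rewrite qZ exprVn mulrC.
Qed.

Let ray_sph x : sph x -> ray (q (vec_mx x)).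
Proof.
case=> Wx x1; exists (vec_mx x); last by rewrite fnorm_sqr x1 divr1.
split => //; apply/eqP => x0; move: x1; rewrite x0 -[0 in LHS](scale0r 0) finnerZr mul0r.
by move/eqP; rewrite eq_sym oner_eq0.
Qed.

(** By homogeneity of degree 2, the quotients are exactly the values of [q] on the compact set
    [sph]. *)
Lemma rayleigh_extrema : minimum ray !=set0 /\ maximum ray !=set0.
Proof.
have sph0 : sph !=set0 by have [x sx _] := normalize WD0 D0n0; exists x.
have cqs : {within sph, continuous (fun x : 'rV[R]_(m * n) => q (vec_mx x))}.
  exact: continuous_subspaceT.
have [x xs xmin] := EVT_min_rV sph0 sph_compact cqs.
have [y ys ymax] := EVT_max_rV sph0 sph_compact cqs.
rewrite !inE in xs ys; split.
  exists (q (vec_mx x)); split; first exact: ray_sph.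
  move=> _ [D [WD Dn0] <-]; have [z sz <-] := normalize WD Dn0.
  by apply: xmin; rewrite inE.
exists (q (vec_mx y)); split; first exact: ray_sph.
move=> _ [D [WD Dn0] <-]; have [z sz <-] := normalize WD Dn0.
by apply: ymax; rewrite inE.
Qed.

End RayleighExtrema.

(** * Orthogonal projection onto the tangent space *)

Section OrthogonalProjection.
Variable R : realType.

(** Solvability of the normal equations [c V V^T = x V^T]: by positivity the row space of [V] meets
    the kernel of [V^T] trivially, so [V V^T] has the same rank, hence the same row space, as
    [V^T]. *)
Lemma orth_decomp k N (V : 'M[R]_(k, N)) (x : 'rV[R]_N) :
  exists c : 'rV[R]_k, (x - c *m V) *m V^T = 0.
Proof.
have kerV : (V :&: kermx V^T)%MS = 0.
  apply/eqP; rewrite -submx0; apply/rV_subP => w.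
  rewrite sub_capmx => /andP[/submxP[c wE] /sub_kermxP wV]; rewrite submx0.
  apply/eqP/finner_eq0; rewrite /finner mxtrace_mulC.
  by rewrite {2}wE trmx_mul mulmxA wV mul0mx linear0.
have rk : \rank (V *m V^T) = \rank V^T.
  by rewrite mxrank_tr -[RHS](mxrank_mul_ker V V^T) kerV mxrank0 addn0.
have sub : (V^T <= V *m V^T)%MS.
  by have [_ <-] := mxrank_leqif_sup (submxMl V V^T); rewrite rk.
have /submxP [c cE] := submx_trans (submxMl x V^T) sub.
by exists c; rewrite mulmxBl cE mulmxA subrr.
Qed.

Lemma finner_mxvec m n (U D : 'M[R]_(m, n)) :
  finner U D = (mxvec U *m (mxvec D)^T) 0 0.
Proof.
rewrite finnerE pair_big /= mxE (reindex _ (curry_mxvec_bij _ _)) /=.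
by apply: eq_bigr => -[i j] _; rewrite mxE /= !mxvecE.
Qed.

Variables (n m p : nat).
Implicit Types K D U : 'M[R]_(m + n, p + n).

Fact tangent_is_linear K : linear (tangent K).
Proof.
move=> a S T; rewrite /tangent scale_block_mx add_block_mx scaler0 addr0.
by congr block_mx; rewrite ?(mulmxDr, mulmxDl) -?scalemxAr -?scalemxAl;
  mxring.
Qed.

HB.instance Definition _ K :=
  GRing.isLinear.Build R _ _ _ (tangent K) (tangent_is_linear K).

Lemma TOperpP K D : in_Vn K -> controllable (AK K) (BK K) ->
  TOperp K D <-> in_Vn D /\ forall S, finner (tangent K S) D = 0.
Proof.
move=> KV cK; split=> -[DV h]; split=> //.
  by move=> S; exact/h/tangent_TO.
by move=> U /(TO_tangent cK)[S ->]; exact: h.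
Qed.

Lemma in_VnB D U : in_Vn D -> in_Vn U -> in_Vn (D - U).
Proof.
rewrite /in_Vn /= => D0 U0; have -> : ulsubmx (D - U) = ulsubmx D - ulsubmx U.
  by apply/matrixP => i j; rewrite !mxE.
by rewrite D0 U0 subrr.
Qed.

(** The tangent space is the range of a linear map, so [orth_decomp] applied to its matrix gives a
    witness; whatever [xget] selects is then tangent with orthogonal remainder. *)
Lemma ProjTOP K D : in_Vn K -> controllable (AK K) (BK K) -> in_Vn D ->
  exists2 S, ProjTO K D = tangent K S & TOperp K (D - tangent K S).
Proof.
move=> KV cK DV.
have [c cE] := orth_decomp (lin_mx (tangent K)) (mxvec D).
have perp : TOperp K (D - tangent K (vec_mx c)).
  apply/TOperpP => //; split.
    by apply: in_VnB => //; rewrite /in_Vn /= block_mxKul.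
  move=> S; rewrite finnerC finner_mxvec -mul_vec_lin trmx_mul mulmxA.
  by rewrite linearB /= -(mul_rV_lin _ c) cE mul0mx mxE.
rewrite /ProjTO; case: xgetP => [U _ [UT Uperp]|/(_ (tangent K (vec_mx c)))[]//].
  by case: (TO_tangent cK UT) Uperp => S -> Uperp; exists S.
by split=> //; exact: tangent_TO.
Qed.

Lemma ProjTO_pythagoras K D : in_Vn K -> controllable (AK K) (BK K) -> in_Vn D ->
  fnorm D ^+ 2 - fnorm (ProjTO K D) ^+ 2 = fnorm (D - ProjTO K D) ^+ 2.
Proof.
move=> KV cK DV; have [S -> [_ /(_ _ (tangent_TO S KV)) h]] := ProjTOP KV cK DV.
rewrite !fnorm_sqr; move: h; set U := tangent K S; rewrite finnerBr => h.
rewrite finnerBr ![finner (_ - _) _]finnerC !finnerBr [finner D U]finnerC; lra.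
Qed.

(** With [U] the projection, [|U|^2 = <U, D> = <U, D - E> <= |U| |D - E|]. One orthogonal vector
    close to [D] thus bounds the projection without computing it. *)
Lemma ProjTO_le K D E : in_Vn K -> controllable (AK K) (BK K) -> in_Vn D ->
  TOperp K E -> fnorm (ProjTO K D) <= fnorm (D - E).
Proof.
move=> KV cK DV [_ /(_ _ (tangent_TO _ KV)) hE].
have [S -> [_ /(_ _ (tangent_TO S KV)) h]] := ProjTOP KV cK DV.
have [->|U0] := eqVneq (fnorm (tangent K S)) 0; first exact: fnorm_ge0.
have Ugt : 0 < fnorm (tangent K S) by rewrite lt_def U0 fnorm_ge0.
rewrite -(ler_pM2l Ugt); apply: le_trans (finner_cauchy _ _).
rewrite -expr2 fnorm_sqr finnerBr hE subr0.
by move: h; rewrite finnerBr => /eqP; rewrite subr_eq0 => /eqP ->.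
Qed.

End OrthogonalProjection.

(** * Continuity of matrix expressions *)

Section ContinuousMatrixFunctions.
Variables (R : realType) (T : topologicalType).

Lemma mxcont_cst m n (A : 'M[R]_(m, n)) : mxcont (fun _ : T => A).
Proof. by move=> i j; exact: cst_continuous. Qed.

Lemma mxcontD m n (f g : T -> 'M[R]_(m, n)) :
  mxcont f -> mxcont g -> mxcont (fun x => f x + g x).
Proof.
move=> cf cg i j; rewrite (_ : (fun _ => _) = (fun x => f x i j) \+ (fun x => g x i j)).
  by move=> x; apply: continuousD; [exact: cf|exact: cg].
by apply/funext => x; rewrite mxE.
Qed.

Lemma mxcontN m n (f : T -> 'M[R]_(m, n)) : mxcont f -> mxcont (fun x => - f x).
Proof.
move=> cf i j; rewrite (_ : (fun _ => _) = (fun x => - (f x i j))).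
  by move=> x; apply: continuousN; exact: cf.
by apply/funext => x; rewrite mxE.
Qed.

Lemma mxcontM m n p (f : T -> 'M[R]_(m, n)) (g : T -> 'M[R]_(n, p)) :
  mxcont f -> mxcont g -> mxcont (fun x => f x *m g x).
Proof.
move=> cf cg i j; rewrite (_ : (fun _ => _) = (fun x => \sum_k f x i k * g x k j)).
  by apply: continuous_sumr => k x; apply: continuousM; [exact: cf|exact: cg].
by apply/funext => x; rewrite mxE.
Qed.

Lemma mxcont_sub m n m' n' (f : T -> 'M[R]_(m, n)) (r : 'I_m' -> 'I_n' -> 'I_m)
    (s : 'I_m' -> 'I_n' -> 'I_n) (g : 'M[R]_(m, n) -> 'M[R]_(m', n')) :
  (forall M i j, g M i j = M (r i j) (s i j)) -> mxcont f -> mxcont (fun x => g (f x)).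
Proof.
move=> gE cf i j.
rewrite (_ : (fun _ => _) = (fun x => f x (r i j) (s i j))); first exact: cf.
by apply/funext => x.
Qed.

Lemma mxcontT m n (f : T -> 'M[R]_(m, n)) : mxcont f -> mxcont (fun x => (f x)^T).
Proof.
by apply: (mxcont_sub (r := fun _ j => j) (s := fun i _ => i)) => M i j; rewrite mxE.
Qed.

Lemma mxcont_lyap_solve n (A : 'M[R]_n) (f : T -> 'M[R]_n) :
  mxcont f -> mxcont (fun x => lyap_solve A (f x)).
Proof.
move=> cf; apply: mxcontN.
apply: (@mxcont_sub _ _ _ _ (fun x => mxvec (f x) *m invmx (lyap_mx A))
  (fun _ _ => 0) (@mxvec_index n n) (@vec_mx R n n)); first by move=> M i j; rewrite mxE.
apply: mxcontM; last exact: mxcont_cst.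
move=> i k; rewrite (ord1 i); case/mxvec_indexP: k => k l.
rewrite (_ : (fun _ => _) = (fun x => f x k l)); first exact: cf.
by apply/funext => x; rewrite mxvecE.
Qed.

Lemma continuous_mxtrace n (f : T -> 'M[R]_n) : mxcont f -> continuous (fun x => \tr (f x)).
Proof. by move=> cf; apply: continuous_sumr => i; exact: cf. Qed.

End ContinuousMatrixFunctions.

Lemma lyap_solveZ (R : fieldType) n (A Q : 'M[R]_n) a :
  lyap_solve A (a *: Q) = a *: lyap_solve A Q.
Proof. by rewrite /lyap_solve !linearZ /= -scalemxAl linearZ scalerN. Qed.

Lemma finner_delta (R : realType) m n (D : 'M[R]_(m, n)) i j :
  finner (delta_mx i j) D = D i j.
Proof.
rewrite finnerE (bigD1 i) //= (bigD1 j) //= mxE !eqxx mul1r.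
rewrite !big1 ?addr0 // => [k ki|k kj]; last by rewrite mxE (negPf kj) andbF mul0r.
by rewrite big1 // => l _; rewrite mxE (negPf ki) mul0r.
Qed.

(** * The Hessian as a quadratic form: invariance, formula, extrema *)

Section HessianOptimum.
Variables (R : realType) (n m p : nat) (P : lqg R n m p).
Local Notation A := (plantA P).
Local Notation B := (plantB P).
Local Notation C := (plantC P).
Variables (F : 'M[R]_(m, n)) (G : 'M[R]_(n, p)) (M S : 'M[R]_n).
Hypothesis ric : riccati P F G M S.
Hypotheses (sNo : stable (A - G *m C)) (sNc : stable (A - B *m F)).

Local Notation K := (Kopt P F G).
Implicit Types D : 'M[R]_(m + n, p + n).

Let HessZ D Z := Hess_Kopt (D := D) (Z := Z) ric sNo sNc.

(* Adding [tangent K T] to [D] changes the linearized loop of [D] by a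
   similarity transformation, so it does not change the H2 norm. *)
Lemma Hess_tangent D T :
  Hess P K (D + tangent K T) (D + tangent K T) = Hess P K D D.
Proof.
have i0 := @lyap_inj_Alin0 _ _ _ _ P F G sNo sNc D.
have eZ := lyap_solveP (Glin G D 0 *m (Glin G D 0)^T) (introT (lyap_injP _) i0).
rewrite (HessZ eZ); set Z := lyap_solve _ _ in eZ *.
(* The similarity is the shear sending [(eta, xi)] to [(eta - T xi, xi)]. *)
pose E : 'M[R]_(n + n) := block_mx 1%:M (- T) 0 1%:M.
set D' := D + _.
have CD : CK D' = CK D + F *m T.
  by rewrite /D' -[tangent _ _]scale1r CK_addZ !CK_block scale1r mulNmx opprK.
have BD : BK D' = BK D + T *m G.
  by rewrite /D' -[tangent _ _]scale1r BK_addZ !BK_block scale1r.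
have AD : AK D' = AK D + (T *m (A - B *m F - G *m C) - (A - B *m F - G *m C) *m T).
  by rewrite /D' -[tangent _ _]scale1r AK_addZ !AK_block scale1r.
have eF : Flin F D' *m E = Flin F D.
  by rewrite mul_row_block !mulmx1 mulmx0 addr0 CD mulmxN addrC addrK.
have eG : E *m Glin G D 0 = Glin G D' 0.
  rewrite mul_block_col !mul1mx mul0mx add0r !scale0r addr0 mulNmx.
  by rewrite /Glin scale0r addr0 BD opprD.
have eA : E *m Alin P F G D 0 = Alin P F G D' 0 *m E.
  rewrite /Alin !scale0r !mulmx_block !(mulmx0, mul0mx, addr0, add0r, mulmx1, mul1mx).
  rewrite subr0 CD BD AD !(mulmxDr, mulmxDl, mulmxN, mulNmx) !mulmxA.
  by congr block_mx; mxring.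
rewrite -eF !trmx_mul !mulmxA.
rewrite (HessZ (Z := E *m Z *m E^T)); first by rewrite !mulmxA.
rewrite -eG !mulmxA -eA -!mulmxA -trmx_mul -eA !trmx_mul.
move/(congr1 (fun Y => E *m Y *m E^T)): eZ.
by rewrite !(mulmxDl, mulmxDr) mulmx0 mul0mx !mulmxA.
Qed.

Hypothesis GF : G *m C = B *m F.

Local Notation L := (lyap_solve (A - B *m F)).
(** When [A - G C = A - B F], the Lyapunov solution at [t = 0] has blocks
    [[hess_M, hess_V; hess_V^T, hess_Y]]. They are found successively from the lower right one,
    because the loop is block triangular with coupling [hess_alpha]. *)
Definition hess_alpha D := B *m CK D - BK D *m C - AK D.
Definition hess_Y := L (G *m G^T).
Definition hess_V D := L (hess_alpha D *m hess_Y - BK D *m G^T).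
Definition hess_M D :=
  L (hess_alpha D *m (hess_V D)^T + hess_V D *m (hess_alpha D)^T + BK D *m (BK D)^T).

Lemma HessE D : Hess P K D D = 2 * (\tr (F *m hess_M D *m F^T)
  + 2 * \tr (F *m hess_V D *m (CK D)^T) + \tr (CK D *m hess_Y *m (CK D)^T)).
Proof.
have iN := introT (lyap_injP _) (stable_lyap_inj sNc).
have eL Q := lyap_solveP Q iN.
have YT : hess_Y^T = hess_Y.
  apply: (lyap_unique (stable_lyap_inj sNc) _ (eL (G *m G^T))).
  have := congr1 trmx (eL (G *m G^T)); rewrite /hess_Y.
  move: (lyap_solve _ _) => Y; move: (A - B *m F) => N.
  by rewrite !raddfD /= trmx0 !trmx_mul !trmxK [_^T *m _^T + _]addrC.
have trV : \tr (CK D *m (hess_V D)^T *m F^T) = \tr (F *m hess_V D *m (CK D)^T).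
  by rewrite -mxtrace_tr !trmx_mul !trmxK mulmxA.
rewrite (@HessZ _ (block_mx (hess_M D) (hess_V D) (hess_V D)^T hess_Y)).
  rewrite /Flin mul_row_block tr_row_mx mul_row_col !mulmxDl !mxtraceD trV; ring.
have eM := eL (hess_alpha D *m (hess_V D)^T + hess_V D *m (hess_alpha D)^T
  + BK D *m (BK D)^T).
have eV := eL (hess_alpha D *m hess_Y - BK D *m G^T).
have eVT := congr1 trmx eV.
move: eM eV eVT (eL (G *m G^T)); rewrite -/(hess_M D) -/(hess_V D) -/hess_Y.
rewrite /Alin /Glin !scale0r GF subr0 !addr0 -/(hess_alpha D).
move: (hess_M D) (hess_V D) hess_Y YT (hess_alpha D) => X V Y YT al.
move: (A - B *m F) => N.
rewrite tr_block_mx tr_col_mx !mulmx_block mul_col_row !add_block_mx !trmx0.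
rewrite !(mulmx0, mul0mx, addr0, add0r) !raddfD !raddfN /= !trmx_mul !trmxK YT ?trmx0.
move=> e1 e2 e3 e4; rewrite -[RHS]block_mx0 ?mulNmx ?mulmxN ?opprK; congr block_mx.
- by rewrite -e1; mxring.
- by rewrite -e2; mxring.
- by rewrite -e3; mxring.
- exact: e4.
Qed.

Lemma HessZZ a D : Hess P K (a *: D) (a *: D) = a ^+ 2 * Hess P K D D.
Proof.
rewrite !HessE.
have CZ : CK (a *: D) = a *: CK D by apply/matrixP => i j; rewrite !mxE.
have BZ : BK (a *: D) = a *: BK D by apply/matrixP => i j; rewrite !mxE.
have AZ : AK (a *: D) = a *: AK D by apply/matrixP => i j; rewrite !mxE.
have alZ : hess_alpha (a *: D) = a *: hess_alpha D.
  by rewrite /hess_alpha CZ BZ AZ -scalemxAr -scalemxAl -!scalerBr.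
have VZ : hess_V (a *: D) = a *: hess_V D.
  by rewrite /hess_V alZ BZ -!scalemxAl -scalerBr lyap_solveZ.
have MZ : hess_M (a *: D) = a ^+ 2 *: hess_M D.
  rewrite /hess_M alZ BZ VZ !linearZ /= -!scalemxAl !scalerA -expr2.
  by rewrite -!scalerDr lyap_solveZ.
rewrite MZ VZ CZ !linearZ /= -?scalemxAl ?linearZ /= -?scalemxAl ?mxtraceZ.
ring.
Qed.

Lemma continuous_Hess :
  continuous (fun x : 'rV[R]_((m + n) * (p + n)) =>
    Hess P K (vec_mx x) (vec_mx x)).
Proof.
rewrite (_ : (fun _ => _) = fun x => 2 * (\tr (F *m hess_M (vec_mx x) *m F^T)
  + 2 * \tr (F *m hess_V (vec_mx x) *m (CK (vec_mx x))^T)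
  + \tr (CK (vec_mx x) *m hess_Y *m (CK (vec_mx x))^T))); last first.
  by apply/funext => x; rewrite HessE.
have cv := @mxcont_vec_mx R (m + n) (p + n).
have cC : mxcont (fun x => CK (vec_mx x : 'M[R]_(m + n, p + n))).
  by apply: (mxcont_sub (r := fun i _ => lshift n i) (s := fun _ j => rshift p j)) cv
    => X i j; rewrite !mxE.
have cB : mxcont (fun x => BK (vec_mx x : 'M[R]_(m + n, p + n))).
  by apply: (mxcont_sub (r := fun i _ => rshift m i) (s := fun _ j => lshift n j)) cv
    => X i j; rewrite !mxE.
have cA : mxcont (fun x => AK (vec_mx x : 'M[R]_(m + n, p + n))).
  by apply: (mxcont_sub (r := fun i _ => rshift m i) (s := fun _ j => rshift p j)) cv
    => X i j; rewrite !mxE.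
have cc := mxcont_cst.
have cal : mxcont (fun x => hess_alpha (vec_mx x)).
  by apply: mxcontD (mxcontN cA); apply: mxcontD (mxcontN _); exact: mxcontM.
have cV : mxcont (fun x => hess_V (vec_mx x)).
  by apply: mxcont_lyap_solve; apply: mxcontD (mxcontN _); exact: mxcontM.
have cM : mxcont (fun x => hess_M (vec_mx x)).
  apply/mxcont_lyap_solve/mxcontD; last by apply: mxcontM (mxcontT _).
  by apply: mxcontD; apply: mxcontM => //; exact: mxcontT.
have h1 := continuous_mxtrace (mxcontM (mxcontM (cc _ _ _ _ F) cM) (cc _ _ _ _ F^T)).
have h2 := continuous_mxtrace (mxcontM (mxcontM (cc _ _ _ _ F) cV) (mxcontT cC)).
have h3 := continuous_mxtrace (mxcontM (mxcontM cC (cc _ _ _ _ hess_Y)) (mxcontT cC)).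
move=> x.
exact: (cvgM (cvg_cst _) (cvgD (cvgD (h1 x) (cvgM (cvg_cst _) (h2 x))) (h3 x))).
Qed.

Hypothesis cK : controllable (AK K) (BK K).

Lemma rayleigh_min_max D0 : TOperp K D0 -> D0 != 0 ->
  minimum (rayleigh P K) !=set0 /\ maximum (rayleigh P K) !=set0.
Proof.
have KV : in_Vn K by rewrite /in_Vn /= block_mxKul.
(* Orthogonality to the coordinate matrices of the upper left block encodes membership in [in_Vn],
   so [TOperp] is cut out by inner products alone. *)
pose W (i : 'I_m * 'I_p + 'M[R]_n) := match i with
  | inl ij => block_mx (delta_mx ij.1 ij.2) 0 0 0 : 'M[R]_(m + n, p + n)
  | inr T => tangent K T end.
have WE D : (forall i, finner (W i) D = 0) <-> TOperp K D.
  have fU ij : finner (W (inl ij)) D = ulsubmx D ij.1 ij.2.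
    rewrite /finner /W -[in LHS](submxK D) tr_block_mx mulmx_block mxtrace_block.
    rewrite !trmx0 !mul0mx !addr0 mxtrace0 addr0 -/(finner _ _) finner_delta.
    by [].
  rewrite (TOperpP D KV cK); split=> [h|[DV h] [ij|T]]; last exact: h.
    split=> [|T]; last exact: (h (inr T)).
    by apply/matrixP => i j; rewrite -(fU (i, j)) h mxE.
  by rewrite fU (DV : ulsubmx D = 0) mxE.
move=> /[dup] D0p /WE WD0 D0n0.
have [] := rayleigh_extrema continuous_Hess HessZZ WD0 D0n0.
rewrite /rayleigh (_ : [set D | _ /\ _] = [set D | TOperp K D /\ D != 0]) //.
by apply/seteqP; split=> D [/WE h1 h2].
Qed.

(** The component [D - ProjTO K D] has the Hessian of [D] by [Hess_tangent], and its squared norm is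
    the denominator by Pythagoras. The strict inequality makes it nonzero, so the quotient belongs
    to [rayleigh]. *)
Lemma minRayleigh_le D : in_Vn D -> fnorm (ProjTO K D) < fnorm D ->
  minRayleigh P K <= Hess P K D D / (fnorm D ^+ 2 - fnorm (ProjTO K D) ^+ 2)
    <= maxRayleigh P K.
Proof.
move=> DV PD; have KV : in_Vn K by rewrite /in_Vn /= block_mxKul.
rewrite ProjTO_pythagoras //.
have [T PE perp] := ProjTOP KV cK DV.
have E0 : D - ProjTO K D != 0.
  apply: contraTneq PD => /eqP; rewrite subr_eq0 => /eqP <-; by rewrite ltxx.
have r : rayleigh P K (Hess P K D D / fnorm (D - ProjTO K D) ^+ 2).
  exists (D - ProjTO K D); first by split=> //; rewrite PE.
  by rewrite PE; have := Hess_tangent (D - tangent K T) T; rewrite subrK => ->.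
rewrite PE in E0 r *; have [mn mx] := rayleigh_min_max perp E0.
apply/andP; split.
  rewrite /minRayleigh; case: xgetP => [y _ [_ ylb]|h]; first exact: ylb.
  by case: mn => y /h.
rewrite /maxRayleigh; case: xgetP => [y _ [_ yub]|h]; first exact: yub.
by case: mx => y /h.
Qed.

End HessianOptimum.

(** * The example *)

Lemma rank_rows (F : fieldType) m n (M : 'M[F]_(m, n)) :
  (forall u : 'rV[F]_m, u *m M = 0 -> u = 0) -> \rank M = m.
Proof.
move=> h; apply/eqP; change (row_free M); rewrite -kermx_eq0.
apply/eqP/row_matrixP => i; rewrite row0; apply: h.
by rewrite -row_mul mulmx_ker row0.
Qed.

(** The Routh-Hurwitz criterion in degree 2. The imaginary part of the characteristic equation
    forces either the real part to be half the trace, or [z] to be real; a nonnegative real [z]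
    would make the characteristic polynomial positive. *)
Lemma stable22 (R : realType) (a b c d : R) : a + d < 0 -> 0 < a * d - b * c ->
  stable (mx_of_rows 2 2 [:: [:: a; b]; [:: c; d]]).
Proof.
move=> tr0 det0 z /eigenvalueP[v]; set N := map_mx _ _ => vN vn0.
pose x := v 0 0; pose y := v 0 (lift ord0 ord0).
have [e1 e2] : x * a%:C%C + y * c%:C%C = z * x /\ x * b%:C%C + y * d%:C%C = z * y.
  split.
    by have /matrixP/(_ 0 0) := vN; rewrite !mxE !big_ord_recl big_ord0 !mxE addr0.
  have /matrixP/(_ 0 (lift ord0 ord0)) := vN.
  by rewrite !mxE !big_ord_recl big_ord0 !mxE addr0.
(* The characteristic polynomial at [z] annihilates both coordinates of the eigenvector, and one of
   them is nonzero. *)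
have chz : z ^+ 2 - (a + d)%:C%C * z + (a * d - b * c)%:C%C = 0.
  have chx : (z ^+ 2 - (a + d)%:C%C * z + (a * d - b * c)%:C%C) * x = 0.
    transitivity ((z - d%:C%C) * (z * x - (x * a%:C%C + y * c%:C%C))
      + c%:C%C * (z * y - (x * b%:C%C + y * d%:C%C))).
      by rewrite !rmorphD !rmorphN !rmorphM /=; ring.
    by rewrite e1 e2 !subrr !mulr0 addr0.
  have chy : (z ^+ 2 - (a + d)%:C%C * z + (a * d - b * c)%:C%C) * y = 0.
    transitivity ((z - a%:C%C) * (z * y - (x * b%:C%C + y * d%:C%C))
      + b%:C%C * (z * x - (x * a%:C%C + y * c%:C%C))).
      by rewrite !rmorphD !rmorphN !rmorphM /=; ring.
    by rewrite e1 e2 !subrr !mulr0 addr0.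
  apply/eqP; apply: contraNT vn0 => ch0.
  have x0 : x = 0 by apply: (mulfI ch0); rewrite chx mulr0.
  have y0 : y = 0 by apply: (mulfI ch0); rewrite chy mulr0.
  by apply/eqP/matrixP => i; rewrite (ord1 i); case=> [[|[|//]] ?]; rewrite mxE;
    [rewrite -[RHS]x0|rewrite -[RHS]y0]; congr (v _ _); apply: val_inj.
case: z {vN e1 e2} chz => r s /eqP; rewrite eq_complex /= => /andP[/eqP h1 /eqP h2].
have {h1} h1 : r ^+ 2 - s ^+ 2 - (a + d) * r + (a * d - b * c) = 0 by rewrite -[RHS]h1; ring.
have {h2} : s * (2 * r - (a + d)) = 0 by rewrite -[RHS]h2; ring.
move/eqP; rewrite mulf_eq0 => /orP[/eqP s0|/eqP h2]; last by lra.
rewrite ltNge; apply/negP => r0; rewrite s0 in h1.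
have := mulr_ge0 r0 (_ : 0 <= - (a + d)); rewrite oppr_ge0 => /(_ (ltW tr0)).
have := sqr_ge0 r; lra.
Qed.

Ltac mx22 := apply/matrixP; case=> [[|[|//]] // ?]; case=> [[|[|//]] // ?];
  rewrite ?(mxE, big_ord_recl, big_ord0) /=.

Section Example.
Variable R : realType.

(** [exM] and [exS] solve the control and filter Riccati equations. The gains are then [F = C] and
    [G = B], whence [G C = B F]. *)
Definition exM (e : R) : 'M[R]_2 := mx_of_rows 2 2 [:: [:: 1; 0]; [:: 0; (1 + e)^-1]].
Definition exS (e : R) : 'M[R]_2 := mx_of_rows 2 2 [:: [:: 1; 0]; [:: 0; 1 + e]].

Definition exN (e : R) : 'M[R]_2 := mx_of_rows 2 2
  [:: [:: - (5 / 2); -1]; [:: - (1 + e); - (5 / 2) * (1 + e)]].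

Lemma exNE e : exA e - exB e *m exC R = exN e.
Proof. by mx22; field. Qed.

Lemma stable_exN (e : R) : 0 < e -> stable (exN e).
Proof. by move=> e0; apply: stable22; nra. Qed.

Lemma KstarE (e : R) : Kstar e = Kopt (ex_lqg e) (exC R) (exB e).
Proof.
by rewrite /Kopt /= -[Kstar e]submxK; congr block_mx; mx22; field.
Qed.

Lemma exM_sym e : (exM e)^T = exM e. Proof. by mx22. Qed.
Lemma exS_sym e : (exS e)^T = exS e. Proof. by mx22. Qed.

Lemma exFE e : 0 < e -> (exB e)^T *m exM e = exC R.
Proof.
move=> e0; apply/matrixP => i; rewrite (ord1 i); case=> [[|[|//]] ?];
  rewrite ?(mxE, big_ord_recl, big_ord0) /=; field; lra.
Qed.

Lemma exGE (e : R) : exS e *m (exC R)^T = exB e.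
Proof.
apply/matrixP => i j; rewrite (ord1 j); case: i => [[|[|//]] ?];
  rewrite ?(mxE, big_ord_recl, big_ord0) /=; ring.
Qed.

Lemma exM_riccati e : 0 < e ->
  (exA e)^T *m exM e + exM e *m exA e + exQ R = (exC R)^T *m exC R.
Proof. by move=> e0; mx22; field; lra. Qed.

Lemma exS_riccati (e : R) :
  exA e *m exS e + exS e *m (exA e)^T + exW e = exB e *m (exB e)^T.
Proof. by mx22; field. Qed.

(* Solutions, found by computer algebra, of the Lyapunov equations behind [hess_Y],
   [hess_V] and [hess_M] for [Delta0] and [Delta1]. Integers are written in base
   1000 because ring numerals are unary. *)
Definition exY (e : R) : 'M[R]_2 := mx_of_rows 2 2
  [:: [:: (10 + 3 * e) / (35 * (2 + e));
          (2 + 2 * e) / (7 * (2 + e))];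
      [:: (2 + 2 * e) / (7 * (2 + e));
          (10 + 17 * e + 7 * e ^+ 2) / (35 * (2 + e))]].
Definition exV0 (e : R) : 'M[R]_2 := mx_of_rows 2 2
  [:: [:: (-14 * e - 5 * e ^+ 2) / (350 * (2 + e) ^+ 2);
          (-7 * e - 6 * e ^+ 2) / (175 * (2 + e) ^+ 2)];
      [:: (7 * e + e ^+ 2) / (175 * (2 + e) ^+ 2);
          (14 * e + 9 * e ^+ 2) / (350 * (2 + e) ^+ 2)]].
Definition exM0 (e : R) : 'M[R]_2 := mx_of_rows 2 2
  [:: [:: (70 * e ^+ 2 + 91 * e ^+ 3 + 25 * e ^+ 4) /
            ((5 * 10 ^+ 3 + 250) * (1 + e) * (2 + e) ^+ 3);
          (-7 * e ^+ 2 - 7 * e ^+ 3 - e ^+ 4) / (525 * (1 + e) * (2 + e) ^+ 3)];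
      [:: (-7 * e ^+ 2 - 7 * e ^+ 3 - e ^+ 4) / (525 * (1 + e) * (2 + e) ^+ 3);
          (70 * e ^+ 2 + 49 * e ^+ 3 + 4 * e ^+ 4) /
            ((5 * 10 ^+ 3 + 250) * (1 + e) * (2 + e) ^+ 3)]].
Definition exV1 (e : R) : 'M[R]_2 := mx_of_rows 2 2
  [:: [:: (-(1 * 10 ^+ 3 + 100) - (1 * 10 ^+ 3 + 144) * e - 311 * e ^+ 2) /
            ((2 * 10 ^+ 3 + 450) * (2 + e) ^+ 2);
          (-550 - 873 * e - 271 * e ^+ 2) / ((1 * 10 ^+ 3 + 225) * (2 + e) ^+ 2)];
      [:: (-550 - 327 * e - 19 * e ^+ 2) / ((1 * 10 ^+ 3 + 225) * (2 + e) ^+ 2);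
          (-(1 * 10 ^+ 3 + 100) - (1 * 10 ^+ 3 + 256) * e - 465 * e ^+ 2 - 49 * e ^+ 3)
            / ((2 * 10 ^+ 3 + 450) * (2 + e) ^+ 2)]].
Definition exM1 (e : R) : 'M[R]_2 := mx_of_rows 2 2
  [:: [:: ((411 * 10 ^+ 3) + ((1 * 10 ^+ 3 + 189) * 10 ^+ 3 + 620) * e +
            ((1 * 10 ^+ 3 + 282) * 10 ^+ 3 + 150) * e ^+ 2 +
            (589 * 10 ^+ 3 + 975) * e ^+ 3 + (97 * 10 ^+ 3 + 297) * e ^+ 4) /
            ((514 * 10 ^+ 3 + 500) * (1 + e) * (2 + e) ^+ 3);
          ((41 * 10 ^+ 3 + 100) + (91 * 10 ^+ 3 + 200) * e +
            (59 * 10 ^+ 3 + 321) * e ^+ 2 + (11 * 10 ^+ 3 + 954) * e ^+ 3 + 20 * e ^+ 4)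
            / ((51 * 10 ^+ 3 + 450) * (1 + e) * (2 + e) ^+ 3)];
      [:: ((41 * 10 ^+ 3 + 100) + (91 * 10 ^+ 3 + 200) * e +
            (59 * 10 ^+ 3 + 321) * e ^+ 2 + (11 * 10 ^+ 3 + 954) * e ^+ 3 + 20 * e ^+ 4)
            / ((51 * 10 ^+ 3 + 450) * (1 + e) * (2 + e) ^+ 3);
          ((411 * 10 ^+ 3) + (634 * 10 ^+ 3 + 380) * e + (414 * 10 ^+ 3 + 850) * e ^+ 2
            + (150 * 10 ^+ 3 + 865) * e ^+ 3 + (29 * 10 ^+ 3 + 278) * e ^+ 4 +
            (2 * 10 ^+ 3 + 58) * e ^+ 5) /
            ((514 * 10 ^+ 3 + 500) * (1 + e) * (2 + e) ^+ 3)]].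

Lemma lyap_solve_eq n (A Q X : 'M[R]_n) : lyap_inj A ->
  A *m X + X *m A^T + Q = 0 -> lyap_solve A Q = X.
Proof.
move=> iA eX; exact: (lyap_unique iA (lyap_solveP _ (introT (lyap_injP _) iA)) eX).
Qed.

Lemma CK_Delta0 : @CK R 2 1 1 (Delta0 R) = 0.
Proof. by rewrite /CK; mx22. Qed.

Lemma BK_Delta0 : @BK R 2 1 1 (Delta0 R) = 0.
Proof. by rewrite /BK; mx22. Qed.

Lemma AK_Delta0 : @AK R 2 1 1 (Delta0 R) =
  mx_of_rows 2 2 [:: [:: - (1 / 2); 1 / 2]; [:: 1 / 2; - (1 / 2)]].
Proof. by rewrite /AK; mx22. Qed.

Lemma CK_Delta1 : @CK R 2 1 1 (Delta1 R) =
  mx_of_rows 1 2 [:: [:: - (1 / 2); - (1 / 2)]].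
Proof. by rewrite /CK; mx22. Qed.

Lemma BK_Delta1 : @BK R 2 1 1 (Delta1 R) = mx_of_rows 2 1 [:: [:: 1 / 2]; [:: 1 / 2]].
Proof. by rewrite /BK; mx22. Qed.

Lemma AK_Delta1 : @AK R 2 1 1 (Delta1 R) = 0.
Proof. by rewrite /AK; mx22. Qed.

Lemma alpha_Delta0 e : hess_alpha (ex_lqg e) (Delta0 R) =
  mx_of_rows 2 2 [:: [:: 1 / 2; - (1 / 2)]; [:: - (1 / 2); 1 / 2]].
Proof.
by rewrite /hess_alpha CK_Delta0 BK_Delta0 AK_Delta0 mulmx0 mul0mx subrr add0r; mx22; field.
Qed.

Lemma alpha_Delta1 e : hess_alpha (ex_lqg e) (Delta1 R) =
  mx_of_rows 2 2 [:: [:: -1; -1]; [:: -1 - e / 2; -1 - e / 2]].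
Proof.
by rewrite /hess_alpha CK_Delta1 BK_Delta1 AK_Delta1 subr0 /=; mx22; field.
Qed.

Section Values.
Variable e : R.
Hypothesis e0 : 0 < e.

Let n1 : 1 + e != 0. Proof. by rewrite gt_eqF // addr_gt0. Qed.
Let n2 : 2 + e != 0. Proof. by rewrite gt_eqF // addr_gt0. Qed.
Let iN : lyap_inj (exN e) := stable_lyap_inj (stable_exN e0).

Lemma exYE : hess_Y (ex_lqg e) (exC R) (exB e) = exY e.
Proof.
rewrite /hess_Y /= exNE.
by apply: (lyap_solve_eq iN); mx22; field; rewrite ?n1 ?n2.
Qed.

Lemma exV0E : hess_V (ex_lqg e) (exC R) (exB e) (Delta0 R) = exV0 e.
Proof.
rewrite /hess_V exYE alpha_Delta0 BK_Delta0 mul0mx subr0 /= exNE.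
by apply: (lyap_solve_eq iN); mx22; field; rewrite ?n1 ?n2.
Qed.

Lemma exM0E : hess_M (ex_lqg e) (exC R) (exB e) (Delta0 R) = exM0 e.
Proof.
rewrite /hess_M exV0E alpha_Delta0 BK_Delta0 mul0mx addr0 /= exNE.
by apply: (lyap_solve_eq iN); mx22; field; rewrite ?n1 ?n2.
Qed.

Lemma exV1E : hess_V (ex_lqg e) (exC R) (exB e) (Delta1 R) = exV1 e.
Proof.
rewrite /hess_V exYE alpha_Delta1 BK_Delta1 /= exNE.
by apply: (lyap_solve_eq iN); mx22; field; rewrite ?n1 ?n2.
Qed.

Lemma exM1E : hess_M (ex_lqg e) (exC R) (exB e) (Delta1 R) = exM1 e.
Proof.
rewrite /hess_M exV1E alpha_Delta1 BK_Delta1 /= exNE.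
by apply: (lyap_solve_eq iN); mx22; field; rewrite ?n1 ?n2.
Qed.

End Values.
End Example.

(** * The controller of the example and its Rayleigh quotients *)

Section ExampleController.
Variables (R : realType) (e : R).
Hypothesis e0 : 0 < e.

Let n1 : 1 + e != 0. Proof. by rewrite gt_eqF // addr_gt0. Qed.
Let n2 : 2 + e != 0. Proof. by rewrite gt_eqF // addr_gt0. Qed.

Lemma CK_Kstar : @CK R 2 1 1 (Kstar e) = mx_of_rows 1 2 [:: [:: -1; -1]].
Proof. by rewrite /CK; mx22. Qed.

Lemma BK_Kstar : @BK R 2 1 1 (Kstar e) = exB e.
Proof. by rewrite /BK; mx22. Qed.

Lemma AK_Kstar : @AK R 2 1 1 (Kstar e) =
  mx_of_rows 2 2 [:: [:: - (7 / 2); -2]; [:: -2 * (1 + e); - (7 / 2) * (1 + e)]].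
Proof. by rewrite /AK; mx22. Qed.

Lemma in_Vn_Kstar : @in_Vn R 2 1 1 (Kstar e).
Proof. by rewrite /in_Vn /=; mx22. Qed.

Lemma rV2_eq0 (u : 'rV[R]_2) : u 0 0 = 0 -> u 0 (lift ord0 ord0) = 0 -> u = 0.
Proof.
move=> u0 u1; apply/rowP; case=> [[|[|//]] i]; rewrite mxE.
  by rewrite -[RHS]u0; congr (u _ _); apply: val_inj.
by rewrite -[RHS]u1; congr (u _ _); apply: val_inj.
Qed.

(** The determinant of [[B_K, A_K B_K]] is [- (3 / 2) e (1 + e)]: controllability is lost in the
    limit [e = 0]. *)
Lemma controllable_Kstar : controllable (@AK R 2 1 1 (Kstar e)) (BK (Kstar e)).
Proof.
rewrite /controllable AK_Kstar BK_Kstar; apply: rank_rows => u; rewrite mul_mxrow => u0.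
have uE (i : 'I_2) : u *m (mx_of_rows 2 2 [:: [:: - (7 / 2); -2];
    [:: -2 * (1 + e); - (7 / 2) * (1 + e)]] ^+ i *m exB e) = 0.
  by have /(congr1 (fun M => submxrow M i)) := u0; rewrite mxrowK submxrow0.
have /matrixP/(_ 0 0) := uE 0; have /matrixP/(_ 0 0) := uE (lift ord0 ord0).
rewrite expr0 mul1mx /= expr1 !mxE !big_ord_recl !big_ord0 !mxE /=.
rewrite !big_ord_recl !big_ord0 !mxE /=.
move: (u 0 0) (u 0 (lift ord0 ord0)) (@rV2_eq0 u) => x y u2 h1 h2.
have xE : x = - (y * (1 + e)) by lra.
have : y * e * (1 + e) = 0 by rewrite xE in h1; nra.
move/eqP; rewrite !mulf_eq0 (negPf n1) orbF (gt_eqF e0) orbF => /eqP y0.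
by apply: u2 => //; rewrite xE y0 mul0r oppr0.
Qed.

(** Here the determinant is [- (3 / 2) e]. *)
Lemma observable_Kstar : observable (CK (Kstar e)) (@AK R 2 1 1 (Kstar e)).
Proof.
rewrite /observable AK_Kstar CK_Kstar -mxrank_tr tr_mxcol.
apply: rank_rows => u; rewrite mul_mxrow => u0.
have uE (i : 'I_2) : u *m (mx_of_rows 1 2 [:: [:: -1; -1]] *m
    mx_of_rows 2 2 [:: [:: - (7 / 2); -2];
    [:: -2 * (1 + e); - (7 / 2) * (1 + e)]] ^+ i)^T = 0.
  by have /(congr1 (fun M => submxrow M i)) := u0; rewrite mxrowK submxrow0.
have /matrixP/(_ 0 0) := uE 0; have /matrixP/(_ 0 0) := uE (lift ord0 ord0).
rewrite expr0 mulmx1 /= expr1 !mxE !big_ord_recl !big_ord0 !mxE /=.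
rewrite !big_ord_recl !big_ord0 !mxE /=.
move: (u 0 0) (u 0 (lift ord0 ord0)) (@rV2_eq0 u) => x y u2 h1 h2.
have xE : x = - y by lra.
have : y * e = 0 by rewrite xE in h1; nra.
move/eqP; rewrite mulf_eq0 (gt_eqF e0) orbF => /eqP y0.
by apply: u2 => //; rewrite xE y0 oppr0.
Qed.

Let sN : stable (plantA (ex_lqg e) - plantB (ex_lqg e) *m exC R).
Proof. by rewrite /= exNE; exact: stable_exN. Qed.

Lemma ex_riccati : riccati (ex_lqg e) (exC R) (exB e) (exM e) (exS e).
Proof.
split=> //.
- exact: exM_sym.
- exact: exFE.
- exact: exM_riccati.
- exact: exS_sym.
- exact: exGE.
- exact: exS_riccati.
Qed.

Lemma Kstar_optimal : globally_optimal (ex_lqg e) (Kstar e).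
Proof.
rewrite KstarE; exact: (Kopt_optimal ex_riccati).
Qed.

Lemma HessK_E D : HessK e D =
  2 * (\tr (exC R *m hess_M (ex_lqg e) (exC R) (exB e) D *m (exC R)^T)
  + 2 * \tr (exC R *m hess_V (ex_lqg e) (exC R) (exB e) D *m (CK D)^T)
  + \tr (CK D *m hess_Y (ex_lqg e) (exC R) (exB e) *m (CK D)^T)).
Proof.
rewrite /HessK KstarE; exact: (HessE ex_riccati).
Qed.

Lemma HessK_Delta0 :
  HessK e (Delta0 R) = e ^+ 4 * (3 / (875 * (1 + e) * (2 + e) ^+ 3)).
Proof.
rewrite HessK_E exM0E // exV0E // exYE // CK_Delta0 mul0mx trmx0 !mulmx0 mxtrace0.
rewrite mulr0 !addr0 /mxtrace big_ord1 ?(mxE, big_ord_recl, big_ord0) /=.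
by field; rewrite n1 n2.
Qed.

Lemma HessK_Delta1 : HessK e (Delta1 R) =
  (((1 * 10 ^+ 3 + 360) * 10 ^+ 3) + ((3 * 10 ^+ 3 + 400) * 10 ^+ 3) * e
   + ((3 * 10 ^+ 3 + 138) * 10 ^+ 3 + 280) * e ^+ 2
   + ((1 * 10 ^+ 3 + 316) * 10 ^+ 3 + 860) * e ^+ 3
   + (239 * 10 ^+ 3 + 410) * e ^+ 4 + (12 * 10 ^+ 3 + 691) * e ^+ 5)
  / ((85 * 10 ^+ 3 + 750) * (1 + e) * (2 + e) ^+ 3).
Proof.
rewrite HessK_E exM1E // exV1E // exYE // CK_Delta1.
rewrite /mxtrace !big_ord1 ?(mxE, big_ord_recl, big_ord0) /=.
by field; rewrite n1 n2.
Qed.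

Lemma HessK_bounds D : in_Vn D -> fnorm (ProjTO (Kstar e) D) < fnorm D ->
  minR e <= HessK e D / (fnorm D ^+ 2 - fnorm (ProjTO (Kstar e) D) ^+ 2) <= maxR e.
Proof.
have := controllable_Kstar; rewrite /minR /maxR /HessK KstarE => cK.
exact: (minRayleigh_le ex_riccati).
Qed.

Lemma HessK_tangent D S : HessK e (D + tangent (Kstar e) S) = HessK e D.
Proof.
rewrite /HessK KstarE; exact: (Hess_tangent ex_riccati).
Qed.

Lemma HessK0 : HessK e 0 = 0.
Proof.
rewrite /HessK KstarE -[X in Hess _ _ X X](scale0r (0 : 'M[R]_(1 + 2, 1 + 2))).
by rewrite (HessZZ ex_riccati) ?expr0n ?mul0r.
Qed.

Lemma HessK_Delta1_gt0 : 0 < HessK e (Delta1 R).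
Proof.
rewrite HessK_Delta1.
by repeat first [exact: e0|exact: ltr0Sn|exact: ltr01|apply: divr_gt0
  |apply: addr_gt0|apply: mulr_gt0|apply: exprn_gt0].
Qed.

(** The trace of a commutator vanishes. This supplies the nonzero orthogonal direction that
    [Kstar_extrema] requires, for every positive [e]. *)
Lemma TOperp_AK1 : TOperp (Kstar e) (block_mx 0 0 0 1%:M : 'M[R]_(1 + 2, 1 + 2)).
Proof.
apply/TOperpP; [exact: in_Vn_Kstar|exact: controllable_Kstar|].
split=> [|S]; first by rewrite /in_Vn /= block_mxKul.
rewrite finnerC /finner tr_block_mx /tangent mulmx_block mxtrace_block.
rewrite !trmx0 !mul0mx trmx1 mul1mx !add0r mxtrace0 add0r.
by rewrite linearB /= mxtrace_mulC subrr.
Qed.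

Lemma Kstar_extrema : minimum (rayleigh (ex_lqg e) (Kstar e)) !=set0 /\
  maximum (rayleigh (ex_lqg e) (Kstar e)) !=set0.
Proof.
have := TOperp_AK1; have := controllable_Kstar; rewrite KstarE => cK D0.
apply: (rayleigh_min_max ex_riccati) D0 _ => //.
apply/eqP => /(congr1 (fun M : 'M[R]_(1 + 2, 1 + 2) => drsubmx M 0 0)).
by rewrite block_mxKdr !mxE => /eqP; rewrite oner_eq0.
Qed.

(* At distance of order [e] from [Delta0], hence the bound on its projection. *)
Definition perp0 : 'M[R]_(1 + 2, 1 + 2) := mx_of_rows _ _
  [:: [:: 0; - (7 / 4) * e; 0];
      [:: 7 / 4 * e; - (1 / 2); (1 + e) / 2];
      [:: 0; 1 / 2; - (1 / 2)]].

Lemma TOperp_perp0 : TOperp (Kstar e) perp0.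
Proof.
apply/TOperpP; [exact: in_Vn_Kstar|exact: controllable_Kstar|].
split=> [|S]; first by rewrite /in_Vn /=; mx22.
rewrite /finner -[perp0]submxK /tangent tr_block_mx mulmx_block mxtrace_block.
rewrite CK_Kstar BK_Kstar AK_Kstar trmx0 mul0mx add0r.
rewrite /mxtrace !big_ord_recl !big_ord0.
rewrite ?(mxE, big_ord_recl, big_ord0) /=.
by field.
Qed.

Lemma fnorm_Delta0 : fnorm (Delta0 R) ^+ 2 = 1.
Proof.
by rewrite fnorm_sqr finnerE !big_ord_recl !big_ord0 !mxE /=; field.
Qed.

Lemma fnorm_Delta1 : fnorm (Delta1 R) ^+ 2 = 1.
Proof.
by rewrite fnorm_sqr finnerE !big_ord_recl !big_ord0 !mxE /=; field.
Qed.

Lemma in_Vn_Delta0 : @in_Vn R 2 1 1 (Delta0 R).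
Proof. by rewrite /in_Vn /=; mx22. Qed.

Lemma in_Vn_Delta1 : @in_Vn R 2 1 1 (Delta1 R).
Proof. by rewrite /in_Vn /=; mx22. Qed.

(** The squared distance from [Delta0] to [perp0] is [(51 / 8) e ^+ 2], below [9 e ^+ 2]. *)
Lemma fnorm_Proj0 : fnorm (ProjTO (Kstar e) (Delta0 R)) <= 3 * e.
Proof.
apply: le_trans (ProjTO_le in_Vn_Kstar controllable_Kstar in_Vn_Delta0 TOperp_perp0) _.
rewrite -ler_sqr ?nnegrE ?fnorm_ge0 //; last by rewrite mulr_ge0 // ltW.
rewrite fnorm_sqr finnerE !big_ord_recl !big_ord0 !mxE /=.
by have := sqr_ge0 e; nra.
Qed.

(** If [Delta1] were tangent to the orbit, its Hessian would vanish by [HessK_tangent], against its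
    positivity. *)
Lemma fnorm_Proj1 : fnorm (ProjTO (Kstar e) (Delta1 R)) < fnorm (Delta1 R).
Proof.
have py := ProjTO_pythagoras in_Vn_Kstar controllable_Kstar in_Vn_Delta1.
rewrite -ltr_sqr ?nnegrE ?fnorm_ge0 // -subr_gt0 py fnorm_sqr.
apply: finner_gt0; apply/eqP => D0.
have [S PE _] := ProjTOP in_Vn_Kstar controllable_Kstar in_Vn_Delta1.
have : HessK e (Delta1 R) = 0.
  by rewrite -(HessK_tangent _ (- S)) linearN /= -PE D0 HessK0.
by apply/eqP; rewrite gt_eqF // HessK_Delta1_gt0.
Qed.

End ExampleController.

(** * Asymptotics *)

Section Asymptotics.
Variable R : realType.
Implicit Types (f g h w : R -> R).

Lemma near_pos : \forall e \near (0 : R)^'+, 0 < e.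
Proof. exact: nbhs_right_gt. Qed.

Lemma addo_cvg0 f h w g : (forall e, 0 < e -> f e = h e + w e * g e) ->
  g e @[e --> 0^'+] --> 0 -> f = h +o_ (0^'+) w.
Proof.
move=> fE g0; apply/eqaddoP => eps eps0.
near=> e; have e0 : 0 < e by near: e; exact: near_pos.
rewrite !fctE fE // addrC addKr normrM mulrC ler_wpM2r //.
near: e; exact: (cvgr0_norm_le _ g0).
Unshelve. all: by end_near. Qed.

Lemma cvg_rat_right (p q : {poly R}) : q.[0] != 0 ->
  p.[e] / q.[e] @[e --> 0^'+] --> p.[0] / q.[0].
Proof.
move=> q0; apply: cvg_at_right_filter.
by apply: cvgM; [exact: continuous_horner|apply: cvgV => //; exact: continuous_horner].
Qed.

Local Notation c0 := (3 / (7 * 10 ^+ 3) : R).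
Local Notation c1 := (680 / 343 : R).

(** The Hessian at [Delta0] with [e ^+ 4] divided out, regular at [e = 0] with value [3 / 7000]. *)
Definition hess0 (e : R) : R := 3 / (875 * (1 + e) * (2 + e) ^+ 3).
Definition proj0 (e : R) : R := fnorm (ProjTO (Kstar e) (Delta0 R)) ^+ 2.

Lemma cvg_HessK0 : hess0 e @[e --> 0^'+] --> c0.
Proof.
pose q : {poly R} := 875%:P * (1%:P + 'X) * (2%:P + 'X) ^+ 3.
have qE e : q.[e] = 875 * (1 + e) * (2 + e) ^+ 3.
  by rewrite /q !(hornerM, hornerD, hornerC, hornerX, horner_exp).
have q0 : q.[0] = 7 * 10 ^+ 3 by rewrite qE; ring.
have qn0 : q.[0] != 0 by rewrite q0 mulf_neq0 ?expf_neq0 ?pnatr_eq0.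
have := @cvg_rat_right 3%:P q qn0; rewrite q0 hornerC.
by under eq_cvg do rewrite hornerC qE.
Qed.

Lemma cvg_HessK1 : HessK e (Delta1 R) @[e --> 0^'+] --> c1.
Proof.
pose p : {poly R} := ((1 * 10 ^+ 3 + 360) * 10 ^+ 3)%:P
   + ((3 * 10 ^+ 3 + 400) * 10 ^+ 3)%:P * 'X
   + ((3 * 10 ^+ 3 + 138) * 10 ^+ 3 + 280)%:P * 'X ^+ 2
   + ((1 * 10 ^+ 3 + 316) * 10 ^+ 3 + 860)%:P * 'X ^+ 3
   + (239 * 10 ^+ 3 + 410)%:P * 'X ^+ 4 + (12 * 10 ^+ 3 + 691)%:P * 'X ^+ 5.
pose q : {poly R} := (85 * 10 ^+ 3 + 750)%:P * (1%:P + 'X) * (2%:P + 'X) ^+ 3.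
have qE e : q.[e] = (85 * 10 ^+ 3 + 750) * (1 + e) * (2 + e) ^+ 3.
  by rewrite /q !(hornerM, hornerD, hornerC, hornerX, horner_exp).
have pE e : p.[e] = ((1 * 10 ^+ 3 + 360) * 10 ^+ 3) + ((3 * 10 ^+ 3 + 400) * 10 ^+ 3) * e
   + ((3 * 10 ^+ 3 + 138) * 10 ^+ 3 + 280) * e ^+ 2
   + ((1 * 10 ^+ 3 + 316) * 10 ^+ 3 + 860) * e ^+ 3
   + (239 * 10 ^+ 3 + 410) * e ^+ 4 + (12 * 10 ^+ 3 + 691) * e ^+ 5.
  by rewrite /p !(hornerM, hornerD, hornerC, hornerX, horner_exp).
have q0 : q.[0] = 2 * 343 * 10 ^+ 3 by rewrite qE; ring.
have p0 : p.[0] = 2 * 680 * 10 ^+ 3 by rewrite pE; ring.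
have qn0 : q.[0] != 0 by rewrite q0 !mulf_neq0 ?expf_neq0 ?pnatr_eq0.
have -> : c1 = p.[0] / q.[0] by rewrite p0 q0; field.
apply: cvg_trans (cvg_rat_right (p := p) qn0); apply: near_eq_cvg.
by near=> e; rewrite pE qE HessK_Delta1 //; near: e; exact: near_pos.
Unshelve. all: by end_near. Qed.

Lemma cvg_proj0 : proj0 e @[e --> 0^'+] --> 0.
Proof.
have l0 : 9 * e ^+ 2 @[e --> (0 : R)^'+] --> (0 : R).
  have := @cvg_rat_right (9%:P * 'X ^+ 2) 1%:P.
  rewrite !(hornerXn, hornerM, hornerC) expr0n mulr0 mul0r => /(_ (oner_neq0 _)).
  by under eq_cvg do rewrite !(hornerXn, hornerM, hornerC) divr1.
apply: (@squeeze_cvgr _ _ _ _ (fun=> 0) (fun e => 9 * e ^+ 2)) => //; last exact: cvg_cst.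
near=> e; have e0 : 0 < e by near: e; exact: near_pos.
rewrite /proj0 sqr_ge0 /=; have := fnorm_Proj0 e0.
have := fnorm_ge0 (ProjTO (Kstar e) (Delta0 R)).
by nra.
Unshelve. all: by end_near. Qed.

Lemma cvg_ratio0 : hess0 e / (1 - proj0 e) @[e --> 0^'+] --> c0.
Proof.
have -> : c0 = c0 / (1 - 0) by rewrite subr0 divr1.
apply: cvgM; first exact: cvg_HessK0.
apply: cvgV; first by rewrite subr0 oner_neq0.
by apply: cvgB cvg_proj0; exact: cvg_cst.
Qed.

Lemma near_proj0 : \forall e \near (0 : R)^'+, proj0 e < 1.
Proof. exact: (cvgr_lt _ cvg_proj0 _ ltr01). Qed.

End Asymptotics.

Theorem theorem4p4 (R : realType) :
  (forall e : R, 0 < e ->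
     globally_optimal (ex_lqg e) (Kstar e)
     /\ controllable_observable (Kstar e)
     /\ HessK e (Delta0 R)
          = derive1n 2 (fun t => J (ex_lqg e) (Kstar e + t *: Delta0 R)) 0
     /\ HessK e (Delta1 R)
          = derive1n 2 (fun t => J (ex_lqg e) (Kstar e + t *: Delta1 R)) 0
     /\ minimum (rayleigh (ex_lqg e) (Kstar e)) !=set0
     /\ maximum (rayleigh (ex_lqg e) (Kstar e)) !=set0)
  /\ (fun e : R => HessK e (Delta0 R)) =
       (fun e => 3 / (7 * 10 ^+ 3) * e ^+ 4) +o_ (0^'+) (fun e => e ^+ 4)
  /\ (fun e : R => HessK e (Delta1 R)) =
       (fun=> 680 / 343) +o_ (0^'+) (fun=> 1 : R)
  /\ (fun e : R => fnorm (ProjTO (Kstar e) (Delta0 R))) =O_ (0^'+) (fun e => e)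
  /\ (\forall e \near (0 : R)^'+,
        minR e <= HessK e (Delta0 R)
                  / (fnorm (Delta0 R) ^+ 2
                     - fnorm (ProjTO (Kstar e) (Delta0 R)) ^+ 2))
  /\ (fun e : R => HessK e (Delta0 R)
                   / (fnorm (Delta0 R) ^+ 2
                      - fnorm (ProjTO (Kstar e) (Delta0 R)) ^+ 2)) =
       (fun e => 3 / (7 * 10 ^+ 3) * e ^+ 4) +o_ (0^'+) (fun e => e ^+ 4)
  /\ (\forall e \near (0 : R)^'+,
        HessK e (Delta1 R) / fnorm (Delta1 R) ^+ 2 <= maxR e)
  /\ (fun e : R => HessK e (Delta1 R) / fnorm (Delta1 R) ^+ 2) =
       (fun=> 680 / 343) +o_ (0^'+) (fun=> 1 : R)
  /\ (exists2 r : R -> R,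
        r =o_ (0^'+) (fun e => e ^+ 4) &
        \forall e \near (0 : R)^'+,
          rcondK e <= 147 / (68 * 10 ^+ 4) * e ^+ 4 + r e)
  /\ `|147 / (68 * 10 ^+ 4) - 216 / 10 ^+ 6| <= 5 / 10 ^+ 7 :> R.
Proof.
have q0E e : 0 < e -> HessK e (Delta0 R)
    / (fnorm (Delta0 R) ^+ 2 - fnorm (ProjTO (Kstar e) (Delta0 R)) ^+ 2)
    = e ^+ 4 * (hess0 e / (1 - proj0 e)).
  by move=> e0; rewrite HessK_Delta0 // fnorm_Delta0 /hess0 /proj0 !mulrA.
have minle : \forall e \near (0 : R)^'+, minR e <= e ^+ 4 * (hess0 e / (1 - proj0 e)).
  near=> e; have e0 : 0 < e by near: e; exact: near_pos.
  have p1 : proj0 e < 1 by near: e; exact: near_proj0.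
  rewrite -q0E //; apply: (andP (HessK_bounds e0 (in_Vn_Delta0 R) _)).1.
  by rewrite -ltr_sqr ?nnegrE ?fnorm_ge0 // fnorm_Delta0.
(* As the Hessian is positive, enlarging the denominator to the full squared norm only lowers the
   quotient; [fnorm_Proj1] keeps the smaller denominator positive. *)
have maxge e : 0 < e -> HessK e (Delta1 R) <= maxR e.
  move=> e0; have P1 := fnorm_Proj1 e0.
  apply: le_trans (andP (HessK_bounds e0 (in_Vn_Delta1 R) P1)).2.
  move: P1; rewrite -ltr_sqr ?nnegrE ?fnorm_ge0 // fnorm_Delta1 => P1.
  rewrite ler_pdivlMr ?subr_gt0 // ler_piMr ?(ltW (HessK_Delta1_gt0 e0)) //.
  by rewrite gerBl sqr_ge0.
have cst_o (c : R) (f : R -> R) : f e @[e --> 0^'+] --> c ->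
    f = (fun=> c) +o_ (0^'+) (fun=> 1 : R).
  move=> fc; apply: (@addo_cvg0 _ _ _ _ (fun e => f e - c)) => [e _|].
    by rewrite mul1r addrC subrK.
  by have := cvgB fc (cvg_cst c); rewrite subrr; exact.
have pow_o (c : R) (f g : R -> R) : (forall e, 0 < e -> f e = e ^+ 4 * g e) ->
    g e @[e --> 0^'+] --> c -> f = (fun e => c * e ^+ 4) +o_ (0^'+) (fun e => e ^+ 4).
  move=> fE gc; apply: (@addo_cvg0 _ _ _ _ (fun e => g e - c)) => [e e0|].
    by rewrite fE //; ring.
  by have := cvgB gc (cvg_cst c); rewrite subrr; exact.
split.
  move=> e e0; split; first exact: Kstar_optimal.
  split; first by split; [exact: controllable_Kstar|exact: observable_Kstar].
  by split; [|split]; [exact: derive_derive_line..|exact: Kstar_extrema].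
split; first by apply: (pow_o _ _ (@hess0 R)) (@cvg_HessK0 R) => e; exact: HessK_Delta0.
split; first by apply: cst_o; exact: cvg_HessK1.
split.
  (* Any constant [k >= 3] works, by [fnorm_Proj0]. *)
  apply/eqOP; near=> k; near=> e; have e0 : 0 < e by near: e; exact: near_pos.
  rewrite ger0_norm ?fnorm_ge0 // (le_trans (fnorm_Proj0 e0)) // (gtr0_norm e0).
  by rewrite ler_wpM2r ?(ltW e0) //; near: k; apply: nbhs_pinfty_ge; exact: num_real.
split.
  near=> e; have e0 : 0 < e by near: e; exact: near_pos.
  by rewrite q0E //; near: e.
split; first by apply: pow_o q0E _; exact: cvg_ratio0.
split.
  near=> e; have e0 : 0 < e by near: e; exact: near_pos.
  by rewrite fnorm_Delta1 divr1 maxge.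
split.
  by under eq_fun do rewrite fnorm_Delta1 divr1; apply: cst_o; exact: cvg_HessK1.
split.
  pose k : R := 147 / (68 * 10 ^+ 4).
  (* [u e] is the bound on the minimum divided by the bound on the maximum, without the factor
     [e ^+ 4]. Its limit [k] is [3 / 7000] divided by [680 / 343], so [e ^+ 4 * (u e - k)] is the
     remainder. *)
  pose u e : R := hess0 e / (1 - proj0 e) / HessK e (Delta1 R).
  exists (fun e => e ^+ 4 * (u e - k)).
    have uk : u e - k @[e --> 0^'+] --> (0 : R).
      have ck : k = 3 / (7 * 10 ^+ 3) / (680 / 343) by rewrite /k; field.
      have c1n0 : 680 / 343 != 0 :> R by rewrite mulf_neq0 ?invr_eq0 ?pnatr_eq0.
      have uk : u e @[e --> 0^'+] --> k.
        by rewrite ck; exact: (cvgM (@cvg_ratio0 R) (cvgV c1n0 (@cvg_HessK1 R))).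
      by have := cvgB uk (cvg_cst k); rewrite subrr; exact.
    apply/eqoP => eps eps0; near=> e; rewrite normrM mulrC ler_wpM2r //.
    by near: e; exact: (cvgr0_norm_le _ uk).
  near=> e; have e0 : 0 < e by near: e; exact: near_pos.
  have p1 : proj0 e < 1 by near: e; exact: near_proj0.
  have mn : minR e <= e ^+ 4 * (hess0 e / (1 - proj0 e)) by near: e.
  have H1 := HessK_Delta1_gt0 e0; have mx := maxge e e0.
  have mx0 : 0 < maxR e := lt_le_trans H1 mx.
  have -> : 147 / (68 * 10 ^+ 4) * e ^+ 4 + e ^+ 4 * (u e - k)
    = e ^+ 4 * (hess0 e / (1 - proj0 e)) / HessK e (Delta1 R).
    by rewrite /u /k; ring.
  (* Nonnegativity of the numerator allows [maxR e] to be replaced by its lower bound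
     [HessK e (Delta1 R)] in the denominator. *)
  have h_ge0 : 0 <= e ^+ 4 * (hess0 e / (1 - proj0 e)).
    rewrite mulr_ge0 ?exprn_ge0 ?(ltW e0) // divr_ge0 ?subr_ge0 ?(ltW p1) //.
    by rewrite /hess0; repeat first [exact: ltW e0|exact: ler0n|exact: ler01
      |apply: divr_ge0|apply: mulr_ge0|apply: exprn_ge0|apply: addr_ge0].
  rewrite /rcondK /rcond -/(minR e) -/(maxR e).
  apply: le_trans (ler_wpM2r _ mn) _; first by rewrite invr_ge0 ltW.
  by apply: ler_wpM2l => //; rewrite lef_pV2 ?posrE.
rewrite ler_norml; apply/andP; split; lra.
Unshelve. all: by end_near. Qed.
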